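(* Let $\ell=\ell(n)\ge 3$ be either a constant (independent of $n$), or an integer sequence with $\ell(n)\to+\infty$ and $\ell/\log n\to 0$ as $n\to+\infty$. Let $0<p=p(n)=o(1)$. Let $X_\ell$ be the number of $\ell$-term arithmetic progressions contained in the random set $[n]_p$, and let $\sigma_\ell:=\sqrt{\mathbb{V}(X_\ell)}$. Then, as $n\to+\infty$: (a) if $n^2p^{\ell}/(\ell-1)\to c$ for some $c\in\mathbb{R}_+$ (i.e. $0<c<+\infty$), then $X_\ell \stackrel{d}{\longrightarrow}\mathrm{Po}(c/2)$; (b) if $n^2p^{\ell}/(\ell-1)\to+\infty$, then $\left(X_\ell-\mathbb{E}(X_\ell)\right)\sigma_\ell^{-1}\stackrel{d}{\longrightarrow}\mathrm{N}(0,1)$.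
   Context: For $n\in\mathbb{N}$ write $[n]:=\{1,\dots,n\}$. For $3\le\ell\le n$, an $\ell$-AP in $[n]$ is a set $\{a,a+b,\dots,a+(\ell-1)b\}\subseteq[n]$ with integers $a$ and $b\ge 1$; let $\mathcal{A}_\ell$ be the set of all $\ell$-APs in $[n]$. For $p\in[0,1]$, $[n]_p$ is the random subset of $[n]$ that contains each element independently with probability $p$. Put $X_\ell:=\sum_{T\in\mathcal{A}_\ell}\mathbf{1}_{\{T\subseteq[n]_p\}}$. $\mathbb{V}$ denotes variance, $\mathrm{Po}(\lambda)$ the Poisson distribution with mean $\lambda$, $\mathrm{N}(0,1)$ the standard normal distribution, and $\stackrel{d}{\longrightarrow}$ convergence in distribution as $n\to+\infty$. *)

(* Defs.v *)
From HB Require Import structures.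
From mathcomp Require Import all_boot all_order all_algebra.
From mathcomp Require Import all_classical all_reals all_analysis.
From mathcomp Require Import measurable_realfun.

Set Implicit Arguments.
Unset Strict Implicit.
Unset Printing Implicit Defensive.

Import Order.TTheory GRing.Theory Num.Theory.
Import numFieldNormedType.Exports.

Local Open Scope classical_set_scope.
Local Open Scope ring_scope.

Set Warnings "-redundant-canonical-projection".

(* Every set of subsets of a finite type is measurable, as the library does for
   unit, bool and nat; a random subset of I is then a {RV P >-> {set I}}. *)
HB.instance Definition _ (I : finType) := isPointed.Build {set I} finset.set0.
HB.instance Definition _ (I : finType) :=
  @isMeasurable.Build default_measure_display {set I} discrete_measurable
    discrete_measurable0 discrete_measurableC discrete_measurableU.

Definition independent_events d (T : measurableType d) (R : realType)
    (P : probability T R) (I : finType) (E : I -> set T) : Prop :=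
  forall J : {set I},
    P (\bigcap_(i in [set` J]) E i) = (\prod_(i in J) fine (P (E i)))%:E.

Definition binomial_random_set d (T : measurableType d) (R : realType)
    (P : probability T R) (I : finType) (p : R) (A : {RV P >-> {set I}}) : Prop :=
  (forall i, P [set w | i \in A w] = p%:E) /\
  independent_events P (fun i => [set w | i \in A w]).

(* 'I_n stands for {1, ..., n}: the ordinal k stands for the integer k + 1.
   The inclusion in {1, ..., n} forces 1 <= a, so a may range over nat. *)
Definition is_AP (n l : nat) (S : {set 'I_n}) : Prop :=
  exists a b : nat,
    [/\ (1 <= b)%N,
        forall i, (i < l)%N -> (1 <= a + i * b <= n)%N &
        forall k : 'I_n, (k \in S) = [exists i : 'I_l, k.+1 == (a + i * b)%N]].

Definition APs (n l : nat) : {set {set 'I_n}} :=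
  [set S : {set 'I_n} | `[< is_AP l S >] ]%SET.

Section AP_count.
Context d (T : measurableType d) (R : realType) (P : probability T R).
Context (n l : nat) (A : {RV P >-> {set 'I_n}}).

Definition AP_count (w : T) : R := \sum_(S in APs n l) (S \subset A w)%:R.

Let measurable_AP_count : measurable_fun setT AP_count.
Proof.
apply: (@measurableT_comp _ _ _ _ _ _
  (fun B : {set 'I_n} => \sum_(S in APs n l) (S \subset B)%:R : R)) => //.
Qed.

HB.instance Definition _ :=
  isMeasurableFun.Build _ _ _ _ AP_count measurable_AP_count.

End AP_count.
Arguments AP_count {d T R P n} l A w.

Section standardize.
Context d (T : measurableType d) (R : realType) (P : probability T R).
Context (X : {RV P >-> R}).

Definition standardize (w : T) : R :=
  (X w - fine 'E_P[X]) / Num.sqrt (fine 'V_P[X]).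

Let measurable_standardize : measurable_fun setT standardize.
Proof. by apply: measurable_funM => //; exact: measurable_funB. Qed.

HB.instance Definition _ :=
  isMeasurableFun.Build _ _ _ _ standardize measurable_standardize.

End standardize.
Arguments standardize {d T R P} X w.

(* The library's Poisson law lives on nat and its normal law on measurableTypeR R;
   these maps present both as laws of real random variables. *)
Section limit_variables.
Context (R : realType).

Definition nat_to_real (k : nat) : R := k%:R.

Let measurable_nat_to_real : measurable_fun setT nat_to_real.
Proof. by []. Qed.

HB.instance Definition _ :=
  isMeasurableFun.Build _ _ _ _ nat_to_real measurable_nat_to_real.

Definition real_id : measurableTypeR R -> R := idfun.

HB.instance Definition _ :=
  @isMeasurableFun.Build _ _ _ _ real_id (@measurable_id _ _ setT).

(* The argument 0 is a dummy that the definition of poisson_prob ignores. *)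
Definition poisson_variable (lambda : R) : {RV (poisson_prob lambda 0%N) >-> R} :=
  nat_to_real.

Definition std_normal_variable : {RV (normal_prob (0 : R) 1) >-> R} := real_id.

End limit_variables.
Arguments std_normal_variable {R}.

(* The X n may live on different probability spaces; only the law of Y matters. *)
Definition cvg_in_distribution (R : realType)
    (d : nat -> measure_display) (T : forall n, measurableType (d n))
    (P : forall n, probability (T n) R) (X : forall n, {RV (P n) >-> R})
    (d' : measure_display) (T' : measurableType d') (Q : probability T' R)
    (Y : {RV Q >-> R}) : Prop :=
  forall x : R, {for x, continuous (cdf Y)} ->
    cdf (X n) x @[n --> \oo] --> cdf Y x.

(* Main.v *)
(** Only the law of the random set matters, and it is the product weight on the
    subsets of {1, ..., n}.  Both limits are obtained by Stein's method for sums of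
    indicators with local dependence, two progressions being dependent when they meet.

    For the Poisson limit, the Chen-Stein equation has a solution bounded by
    exp(lambda), so the error is the sum of p^|S u S'| over meeting pairs S <> S'.
    For the normal limit, the error is sigma^-3 times the sum of p^|S u S' u S''|
    over triples in which S' and S'' meet S.  The test functions glue the two
    solutions (1 - c) Phi / phi and c (1 - Phi) / phi of the Stein equation of an
    indicator by a smooth step, which gives one-sided bounds on the distribution
    function.

    The combinatorial input: a point lies in at most 2n progressions, two points in at
    most l^2, and progressions meeting a given one in at least two points are either
    shifts of it or share at most half of its elements, so that they contribute
    O(sqrt p).  The variance is bounded below by its diagonal and by Cauchy-Schwarz on
    the degrees, and n p grows like a power of n, which beats any power of l. *)
Require Import Defs.
From mathcomp Require Import all_boot all_order all_algebra.
From mathcomp Require Import all_classical all_reals all_analysis.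
From mathcomp Require Import ring lra zify.
Import Order.TTheory GRing.Theory Num.Theory.
Import numFieldNormedType.Exports.
Local Open Scope classical_set_scope.
Local Open Scope ring_scope.
Set Implicit Arguments.
Unset Strict Implicit.
Unset Printing Implicit Defensive.

(** * The binomial random set *)

(** As l may tend to infinity, large overlaps must be summed without losing powers of l. This is the
    purpose of q = sqrt p. For fixed S, the size of S u S' u S'' is at least the average of |S u S'|
    and |S u S''|. Hence the weight of a triple is at most p^l times a power of q for S' and one for
    S'', and the triple sum over large overlaps becomes the square of a single sum. Triples with a
    one-point intersection are governed by D = 2 n l p^(l-1), which may be unbounded in the normal
    regime; this is why the variance is bounded below in two ways. With m the mean, they give V >= m
    (1 + D) / 34, and the factor (1 + D)^3 in V^3 absorbs the powers of D in the squared cluster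
    sum. What remains is of order l^8 D / m + 1 / m, where D / m is of order l^2 / (n p). The level
    c of a test function lies strictly above the limiting probability, so the smoothing interval and
    the bound K on the second derivative depend on c and x but not on n. For fixed c the Stein error
    then tends to 0, and c is moved to the limiting probability afterwards. *)

Section BinomialWeights.
Context (R : realFieldType) (I : finType) (p : R).
Implicit Types (S U V : {set I}) (f g u v : {set I} -> R).

Definition weight S : R := \prod_i (if i \in S then p else 1 - p).

Definition mean f : R := \sum_S weight S * f S.

Lemma eq_mean f g : f =1 g -> mean f = mean g.
Proof. by move=> fg; apply: eq_bigr => S _; rewrite fg. Qed.

Lemma meanD f g : mean (fun S => f S + g S) = mean f + mean g.
Proof. by rewrite -big_split /=; apply: eq_bigr => S _; rewrite mulrDr. Qed.

Lemma meanN f : mean (fun S => - f S) = - mean f.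
Proof. by rewrite -sumrN; apply: eq_bigr => S _; rewrite mulrN. Qed.

Lemma meanB f g : mean (fun S => f S - g S) = mean f - mean g.
Proof. by rewrite meanD meanN. Qed.

Lemma meanZl c f : mean (fun S => c * f S) = c * mean f.
Proof. by rewrite mulr_sumr; apply: eq_bigr => S _; rewrite mulrCA. Qed.

Lemma mean_sum (J : finType) (Q : pred J) (F : J -> {set I} -> R) :
  mean (fun S => \sum_(j | Q j) F j S) = \sum_(j | Q j) mean (F j).
Proof. by rewrite exchange_big /=; apply: eq_bigr => S _; rewrite mulr_sumr. Qed.

Lemma mean_subset U : mean (fun S => (U \subset S)%:R) = p ^+ #|U|.
Proof.
(* Expanding the product chooses one summand at each i, the first meaning that i lies in S. The zero
   at points of U discards the sets S that miss a point of U. *)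
transitivity (\prod_i ((p : R) + (if i \in U then 0 else 1 - p))).
  rewrite bigA_distr; apply: eq_bigr => S _.
  have [/fintype.subsetP US | /subsetPn[i iU iS]] := boolP (U \subset S).
    rewrite mulr1; apply: eq_bigr => i _.
    by case: ifPn => // iS; rewrite ifN //; apply: contra iS => /US.
  by rewrite mulr0 (bigD1 i) //= (negPf iS) iU mul0r.
rewrite (bigID (mem U)) /= [X in _ * X]big1 ?mulr1.
  rewrite (eq_bigr (fun=> p)) => [|i ->]; last by rewrite addr0.
  by rewrite prodr_const.
by move=> i /negPf ->; rewrite subrKC.
Qed.

Lemma mean1 : mean (fun=> 1) = 1.
Proof.
rewrite -[RHS](expr0 p) -(cards0 I) -mean_subset.
by apply: eq_mean => S; rewrite finset.sub0set.
Qed.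

Lemma mean_cst c : mean (fun=> c) = c.
Proof.
by rewrite -[RHS]mulr1 -mean1 -meanZl; apply: eq_mean => S; rewrite mulr1.
Qed.

(* Exchanging the parts outside V of two independent copies (S, S') is an
   involution which preserves the product weight. *)
Lemma mean_indep V u v :
    (forall S, u S = u (S :&: V)) -> (forall S, v S = v (S :\: V)) ->
  mean (fun S => u S * v S) = mean u * mean v.
Proof.
move=> uV vV.
pose mix S U := (S :&: V) :|: (U :\: V).
pose swap (SU : {set I} * {set I}) := (mix SU.1 SU.2, mix SU.2 SU.1).
have mixI S U : mix S U :&: V = S :&: V.
  by apply/setP => i; rewrite !inE; case: (i \in V); rewrite ?andbT ?andbF ?orbF.
have mixD S U : mix S U :\: V = U :\: V.
  by apply/setP => i; rewrite !inE; case: (i \in V); rewrite ?andbT ?andbF ?orbF.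
have swapK : involutive swap.
  move=> [S U]; rewrite /swap /=; congr pair; rewrite [LHS]/mix mixI mixD;
  exact: finset.setID.
transitivity (\sum_(SU : {set I} * {set I})
   weight SU.1 * weight SU.2 * (u SU.1 * v SU.1)).
  rewrite -(pair_bigA _ (fun S U => weight S * weight U * (u S * v S))) /=.
  apply: eq_bigr => S _; rewrite -[LHS]mulr1 -mean1 mulr_sumr.
  by apply: eq_bigr => U _; rewrite mulr1 mulrAC.
rewrite (reindex_inj (inv_inj swapK)) /= mulr_suml.
rewrite -(pair_bigA _ (fun S U => weight (mix S U) * weight (mix U S) *
  (u (mix S U) * v (mix S U)))) /=.
apply: eq_bigr => S _; rewrite mulr_sumr; apply: eq_bigr => U _.
rewrite uV vV mixI mixD -uV -vV [RHS]mulrACA; congr (_ * _).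
rewrite /weight -!big_split /=; apply: eq_bigr => i _.
by rewrite !inE; case: (i \in V); rewrite /= ?andbT ?andbF ?orbF //= mulrC.
Qed.

Hypothesis p01 : 0 <= p <= 1.

Lemma weight_ge0 S : 0 <= weight S.
Proof.
have /andP[p0 p1] := p01.
by apply: prodr_ge0 => i _; case: ifP; rewrite ?subr_ge0.
Qed.

Lemma le_mean f g : (forall S, f S <= g S) -> mean f <= mean g.
Proof. by move=> fg; apply: ler_sum => S _; rewrite ler_wpM2l ?weight_ge0. Qed.

Lemma mean_ge0 f : (forall S, 0 <= f S) -> 0 <= mean f.
Proof. by move=> f0; rewrite -(mean_cst 0); exact: le_mean. Qed.

Lemma ler_norm_mean f : `|mean f| <= mean (fun S => `|f S|).
Proof.
apply: le_trans (ler_norm_sum _ _ _) _; apply: ler_sum => S _.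
by rewrite normrM ger0_norm ?weight_ge0.
Qed.

End BinomialWeights.

(** Moebius inversion over supersets, by downward induction on the size of J: once all proper
    supersets agree, the two sums can differ only in the term at J. It recovers the law of the
    random set from the probabilities of containing J, which is what independence of the events
    provides. *)
Lemma eq_up_sums (V : zmodType) (I : finType) (m1 m2 : {set I} -> V) :
    (forall J : {set I}, \sum_(S : {set I} | J \subset S) m1 S
             = \sum_(S : {set I} | J \subset S) m2 S) ->
  m1 =1 m2.
Proof.
move=> up J; have [k] := ubnP (#|I| - #|J|).
elim: k J => // k IH J kJ; have := up J.
rewrite (bigD1 J) //= [RHS](bigD1 J) //= (eq_bigr m2) => [|S /andP[JS SJ]].
  exact: addIr.
have ltJS : (#|J| < #|S|)%N by rewrite proper_card // finset.properEneq eq_sym SJ.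
have leSI : (#|S| <= #|I|)%N := max_card _.
by apply: IH; lia.
Qed.

Section RandomSet.
Context d (T : measurableType d) (R : realType) (P : probability T R).
Context (I : finType) (A : {RV P >-> {set I}}).

Lemma measurable_random_set (B : set {set I}) : measurable [set w | B (A w)].
Proof. by apply: (measurable_funPTI A (Y := B)). Qed.

Lemma expectation_random_set_fun (f : {set I} -> R) :
  ('E_P[f \o A] = (\sum_S f S * fine (P [set w | A w = S]))%:E)%E.
Proof.
rewrite unlock.
transitivity (\int[P]_w (\sum_S (f S)%:E * (\1_[set w | A w = S] w)%:E))%E.
  apply: eq_integral => w _; rewrite (bigD1 (A w)) //= big1.
    by rewrite adde0 indicE mem_set //= mule1.
  move=> S SA; rewrite indicE memNset ?mule0 //= => /esym/eqP.
  by rewrite (negPf SA).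
have mA S : measurable [set w | A w = S] by exact: (measurable_random_set [set U | U = S]).
rewrite integral_sum //.
  rewrite -sumEFin; apply: eq_bigr => S _.
  rewrite integralZl //; last exact: integrable_indic.
  by rewrite integral_indic // setIT EFinM fineK // fin_num_measure.
by move=> S; apply: integrableZl => //; exact: integrable_indic.
Qed.

Lemma prob_random_set (Q : pred {set I}) :
  P [set w | Q (A w)] = (\sum_S (Q S)%:R * fine (P [set w | A w = S]))%:E.
Proof.
rewrite -expectation_random_set_fun -expectation_indic; last first.
  by exact: (measurable_random_set (fun V => Q V)).
congr expectation.body; apply/funext => w /=; rewrite indicE /=.
by congr (nat_of_bool _)%:R; apply/idP/idP; rewrite inE.
Qed.

Context (p : R) (A_binomial : binomial_random_set p A).

Lemma binomial_random_set_law S : P [set w | A w = S] = (weight p S)%:E.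
Proof.
have [PA indA] := A_binomial.
have mA U : measurable [set w | A w = U].
  by exact: (measurable_random_set [set V | V = U]).
suff /(_ S) <- : (fun U => fine (P [set w | A w = U])) =1 weight p.
  by rewrite fineK // fin_num_measure.
apply: eq_up_sums => J.
transitivity (p ^+ #|J|); last first.
  rewrite -mean_subset /mean [RHS]big_mkcond; apply: eq_bigr => U _.
  by case: ifP; rewrite ?mulr1 ?mulr0.
apply: EFin_inj; transitivity (P (\bigcap_(i in [set` J]) [set w | i \in A w])); last first.
  by rewrite indA (eq_bigr (fun=> p)) ?prodr_const // => i _; rewrite PA.
rewrite [X in P X](_ : _ = [set w | J \subset A w]); last first.
  apply/seteqP; split=> w /=; first by move=> JA; apply/fintype.subsetP => i /JA.
  by move=> /fintype.subsetP JA i /JA.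
rewrite (prob_random_set (fun U => J \subset U)) big_mkcond; congr EFin.
by apply: eq_bigr => U _; case: ifP; rewrite ?mul1r ?mul0r.
Qed.

Lemma expectation_binomial_random_set (f : {set I} -> R) :
  ('E_P[f \o A] = (mean p f)%:E)%E.
Proof.
rewrite expectation_random_set_fun; congr EFin; apply: eq_bigr => S _.
by rewrite binomial_random_set_law mulrC.
Qed.

Lemma prob_binomial_random_set (Q : pred {set I}) :
  P [set w | Q (A w)] = (mean p (fun S => (Q S)%:R))%:E.
Proof.
rewrite prob_random_set; congr EFin; apply: eq_bigr => S _.
by rewrite binomial_random_set_law mulrC.
Qed.

End RandomSet.

(** * Stein's method under local dependence *)

Section LocalDependence.
Context (R : realFieldType) (I : finType) (p s : R) (F : {set {set I}}).
Hypothesis p01 : 0 <= p <= 1.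
Hypothesis s_ge0 : 0 <= s.
Implicit Types (a b c : {set I}) (S V : {set I}).

Definition meets a b := ~~ [disjoint a & b].

Lemma meetsC a b : meets a b = meets b a.
Proof. by rewrite /meets disjoint_sym. Qed.

Lemma meetsU a b c : meets (a :|: b) c = meets a c || meets b c.
Proof.
by rewrite /meets -!finset.setI_eq0 finset.setIUl finset.setU_eq0 negb_and.
Qed.

Definition cluster_sum : R :=
  \sum_(a in F) \sum_(b in F | meets a b) \sum_(c in F | meets a c)
    p ^+ #|a :|: b :|: c|.

Let X a S : R := (a \subset S)%:R.

(** The scale [s] stays free: it is 1 when the variance is computed and the inverse standard
    deviation in the normal limit. *)
Definition centred a S : R := s * (X a S - p ^+ #|a|).

Definition centred_sum S : R := \sum_(a in F) centred a S.

Let Y := centred.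
Let W := centred_sum.

Let leXp m k : (k <= m)%N -> p ^+ m <= p ^+ k.
Proof. by move=> km; have /andP[p0 p1] := p01; apply: ler_wiXn2l. Qed.

Let X2 a b S : X a S * X b S = X (a :|: b) S.
Proof. by rewrite /X -natrM mulnb finset.subUset. Qed.

Let leYX a S : `|Y a S| <= s * (X a S + p ^+ #|a|).
Proof.
have /andP[p0 _] := p01.
rewrite normrM ger0_norm // ler_wpM2l //; apply: le_trans (ler_normB _ _) _.
by rewrite !ger0_norm ?exprn_ge0.
Qed.

Let meanX a : mean p (X a) = p ^+ #|a|.
Proof. exact: mean_subset. Qed.

(** The 8 counts the terms of the expanded product of the three bounds X + p^|.|. Each term has mean
    at most p^|a u b u c|, because cardinality is subadditive under unions. *)
Lemma mean_norm_centred3 a b c :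
  mean p (fun S => `|centred a S| * `|centred b S| * `|centred c S|)
    <= 8 * s ^+ 3 * p ^+ #|a :|: b :|: c|.
Proof.
pose e a := p ^+ #|a|.
apply: (@le_trans _ _ (mean p (fun S => s ^+ 3 * (X (a :|: b :|: c) S +
  e c * X (a :|: b) S + e b * X (a :|: c) S + e a * X (b :|: c) S +
  e a * e b * X c S + e a * e c * X b S + e b * e c * X a S
  + e a * e b * e c)))).
  apply: le_mean => // S.
  apply: (@le_trans _ _ (s * (X a S + e a) * (s * (X b S + e b)) *
                         (s * (X c S + e c)))).
    by rewrite !ler_pM ?mulr_ge0 ?leYX.
  by rewrite -!X2 le_eqVlt; apply/orP; left; apply/eqP; ring.
rewrite meanZl [8 * _]mulrC -[leRHS]mulrA ler_wpM2l ?exprn_ge0 //.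
rewrite !meanD !meanZl !meanX mean_cst /e -!exprD.
have le2 (u v : {set I}) : (#|u :|: v| <= #|u| + #|v|)%N := leq_card_setU u v.
have [[ab ac] bc] := (le2 a b, le2 a c, le2 b c).
have := (le2 (a :|: b) c, le2 (a :|: c) b, le2 a (b :|: c)).
rewrite [a :|: c :|: b]finset.setUAC [a :|: (b :|: c)]finset.setUA => -[[abc acb bca]].
have -> (x : R) : 8 * x = x + x + x + x + x + x + x + x by ring.
rewrite !lerD // leXp //; lia.
Qed.

(** Counterpart for a mean that has been split off by independence; here 8 arises as 4 terms for the
    pair times 2 for the single factor. *)
Lemma mean_norm_centred21 a b c :
  mean p (fun S => `|centred a S| * `|centred b S|) *
  mean p (fun S => `|centred c S|) <= 8 * s ^+ 3 * p ^+ #|a :|: b :|: c|.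
Proof.
have /andP[p0 _] := p01.
pose e a := p ^+ #|a|.
have mc : mean p (fun S => `|Y c S|) <= s * (2 * e c).
  apply: (@le_trans _ _ (mean p (fun S => s * (X c S + e c)))).
    by apply: le_mean => // S; exact: leYX.
  by rewrite meanZl meanD mean_cst meanX mulr_natl.
have mab : mean p (fun S => `|Y a S| * `|Y b S|) <= s ^+ 2 * (4 * e (a :|: b)).
  apply: (@le_trans _ _ (mean p (fun S => s ^+ 2 * (X (a :|: b) S +
    e b * X a S + e a * X b S + e a * e b)))).
    apply: le_mean => // S.
    apply: (@le_trans _ _ (s * (X a S + e a) * (s * (X b S + e b)))).
      by rewrite ler_pM ?leYX.
    by rewrite -!X2 le_eqVlt; apply/orP; left; apply/eqP; ring.
  rewrite meanZl ler_wpM2l ?exprn_ge0 // !meanD !meanZl !meanX mean_cst /e -!exprD.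
  have -> (x : R) : 4 * x = x + x + x + x by ring.
  have ab : (#|a :|: b| <= #|a| + #|b|)%N := leq_card_setU a b.
  by rewrite !lerD // leXp //; lia.
apply: le_trans (ler_pM _ _ mab mc) _; rewrite ?mean_ge0 //.
have -> : s ^+ 2 * (4 * e (a :|: b)) * (s * (2 * e c))
  = 8 * s ^+ 3 * (e (a :|: b) * e c) by ring.
rewrite ler_wpM2l ?mulr_ge0 ?exprn_ge0 // -exprD leXp //.
exact: leq_card_setU.
Qed.

Lemma mean_centred a : mean p (centred a) = 0.
Proof. by rewrite meanZl meanB mean_cst meanX subrr mulr0. Qed.

Let YI a S : Y a S = Y a (S :&: a).
Proof. by rewrite /Y /centred /X finset.subsetI fintype.subxx andbT. Qed.

Let YD a V S : ~~ meets V a -> Y a S = Y a (S :\: V).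
Proof.
rewrite negbK disjoint_sym => aV.
by rewrite /Y /centred /X finset.subsetD aV andbT.
Qed.

Let YIU a V S : a \subset V -> Y a S = Y a (S :&: V).
Proof. by move=> aV; rewrite /Y /centred /X finset.subsetI aV andbT. Qed.

Lemma mean_centred_indep a (v : {set I} -> R) :
  (forall S, v S = v (S :\: a)) -> mean p (fun S => centred a S * v S) = 0.
Proof. by move=> va; rewrite (mean_indep p (V := a)) // mean_centred mul0r. Qed.

(** [near a] collects the variables that may depend on [Y a], itself included when a is nonempty.
    [far a] reads S only outside a, so it is independent of [Y a]. *)
Let near a S := \sum_(b in F | meets a b) Y b S.
Let far a S := \sum_(b in F | ~~ meets a b) Y b S.

Let WE a S : W S = near a S + far a S.
Proof. by rewrite /W /centred_sum (bigID (meets a)). Qed.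

Let farD a S : far a S = far a (S :\: a).
Proof. by apply: eq_bigr => b /andP[_ ab]; exact: YD. Qed.

Context (f f' : R -> R) (K : R).
Hypothesis f_taylor : forall x y, `|f y - f x - f' x * (y - x)| <= K * (y - x) ^+ 2.
Hypothesis f'_lip : forall x y, `|f' y - f' x| <= K * `|y - x|.

Let K_ge0 : 0 <= K.
Proof. by have := f'_lip 0 1; rewrite subr0 normr1 mulr1; apply: le_trans. Qed.

Let C := K * (8 * s ^+ 3).

Let C_ge0 : 0 <= C. Proof. by rewrite !mulr_ge0 ?exprn_ge0. Qed.

(** As [Y a] has mean zero and is independent of [far a], subtracting f (far a) from f W does not
    change the mean. What is left is the Taylor remainder of f at W, quadratic in [near a] = W -
    [far a]. *)
Lemma stein_first_order a :
  `|mean p (fun S => centred a S * f (centred_sum S)) -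
    mean p (fun S => centred a S * near a S * f' (centred_sum S))|
  <= C * \sum_(b in F | meets a b) \sum_(c in F | meets a c) p ^+ #|a :|: b :|: c|.
Proof.
rewrite -[X in `|X - _|]subr0 -{1}(mean_centred_indep (fun S => congr1 f (farD a S))).
rewrite -!meanB; apply: le_trans (ler_norm_mean p01 _) _.
apply: (@le_trans _ _ (mean p (fun S => K * \sum_(b in F | meets a b)
   \sum_(c in F | meets a c) (`|Y a S| * `|Y b S| * `|Y c S|)))).
  apply: le_mean => // S.
  have -> : centred a S * f (centred_sum S) - centred a S * f (far a S) -
    centred a S * near a S * f' (centred_sum S) =
    - (Y a S * (f (far a S) - f (W S) - f' (W S) * (far a S - W S))).
    by rewrite /Y -/W (WE a S); ring.
  rewrite normrN normrM; apply: le_trans (ler_wpM2l (normr_ge0 _) (f_taylor _ _)) _.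
  rewrite (WE a S) opprD addrCA subrr addr0 sqrrN mulrCA ler_wpM2l //.
  rewrite -(eq_bigr _ (fun b _ => mulr_sumr _ _ _ _)).
  under eq_bigr => b _ do rewrite -mulrA.
  rewrite -mulr_sumr -mulr_suml -real_normK ?num_real // expr2.
  by rewrite ler_wpM2l // ler_pM // ler_norm_sum.
rewrite meanZl /C -mulrA ler_wpM2l // mean_sum mulr_sumr; apply: ler_sum => b _.
by rewrite mean_sum mulr_sumr; apply: ler_sum => c _; exact: mean_norm_centred3.
Qed.

(** The sum [far2] over the sets that meet neither a nor b is independent of the product of [Y a]
    and [Y b]. Replacing W by [far2] costs one Lipschitz error in the product of means and one in
    the joint mean, hence the factor 2. *)
Lemma stein_second_order a b :
  `|mean p (fun S => centred a S * centred b S) *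
      mean p (fun S => f' (centred_sum S)) -
    mean p (fun S => centred a S * centred b S * f' (centred_sum S))|
  <= 2 * C * \sum_(c in F | meets a c || meets b c) p ^+ #|a :|: b :|: c|.
Proof.
pose Q c := meets a c || meets b c.
pose far2 S := \sum_(c in F | ~~ Q c) Y c S.
pose near2 S := \sum_(c in F | Q c) `|Y c S|.
have Wnear S : `|f' (W S) - f' (far2 S)| <= K * near2 S.
  apply: le_trans (f'_lip _ _) _; rewrite ler_wpM2l //.
  by rewrite /W /centred_sum (bigID Q) /= addrK ler_norm_sum.
have far2D S : far2 S = far2 (S :\: (a :|: b)).
  by apply: eq_bigr => c /andP[_ Qc]; apply: YD; rewrite meetsU.
have indep : mean p (fun S => Y a S * Y b S * f' (far2 S)) =
             mean p (fun S => Y a S * Y b S) * mean p (fun S => f' (far2 S)).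
  apply: (mean_indep p (V := a :|: b)) => S; last by rewrite -far2D.
  by congr (_ * _); apply: YIU; rewrite ?finset.subsetUl ?finset.subsetUr.
rewrite (_ : _ - _ = mean p (fun S => Y a S * Y b S) *
    mean p (fun S => f' (W S) - f' (far2 S)) -
    mean p (fun S => Y a S * Y b S * (f' (W S) - f' (far2 S)))); last first.
  rewrite meanB mulrBr -indep -addrA -opprD -meanD; congr (_ - _).
  by apply: eq_mean => S; rewrite -mulrDr subrKC.
have -> : 2 * C * \sum_(c in F | Q c) p ^+ #|a :|: b :|: c| =
   K * (\sum_(c in F | Q c) 8 * s ^+ 3 * p ^+ #|a :|: b :|: c|) +
   K * (\sum_(c in F | Q c) 8 * s ^+ 3 * p ^+ #|a :|: b :|: c|).
  by rewrite -mulr_sumr /C; ring.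
apply: le_trans (ler_normB _ _) _; apply: lerD.
  rewrite normrM; apply: (@le_trans _ _ (mean p (fun S => `|Y a S| * `|Y b S|) *
    (K * mean p near2))).
    apply: ler_pM => //.
      apply: le_trans (ler_norm_mean p01 _) _.
      by apply: le_mean => // S; rewrite normrM.
    by rewrite -meanZl; apply: le_trans (ler_norm_mean p01 _) _; apply: le_mean.
  rewrite mulrCA ler_wpM2l // mean_sum mulr_sumr; apply: ler_sum => c _.
  exact: mean_norm_centred21.
apply: le_trans (ler_norm_mean p01 _) _.
apply: (@le_trans _ _ (mean p (fun S => K *
    \sum_(c in F | Q c) `|Y a S| * `|Y b S| * `|Y c S|))).
  apply: le_mean => // S; rewrite 2!normrM -mulr_sumr mulrCA.
  by rewrite ler_wpM2l ?mulr_ge0.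
rewrite meanZl ler_wpM2l // mean_sum; apply: ler_sum => c _.
exact: mean_norm_centred3.
Qed.

(** The constant is 8 times 5: one cluster sum from the first-order error, and twice two from the
    second-order errors, where c may meet a or b. *)
Lemma stein_local_dependence : mean p (fun S => centred_sum S ^+ 2) = 1 ->
  `|mean p (fun S => f' (centred_sum S) - centred_sum S * f (centred_sum S))|
    <= 40 * K * s ^+ 3 * cluster_sum.
Proof.
move=> W1.
pose T2 a := \sum_(b in F | meets a b)
  (mean p (fun S => Y a S * Y b S) * mean p (fun S => f' (W S)) -
   mean p (fun S => Y a S * Y b S * f' (W S))).
pose T1 a := mean p (fun S => centred a S * f (centred_sum S)) -
    mean p (fun S => centred a S * near a S * f' (centred_sum S)).
have -> : mean p (fun S => f' (centred_sum S) - centred_sum S * f (centred_sum S))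
    = \sum_(a in F) (T2 a - T1 a).
  (* The normalisation E W^2 = 1 is inserted as a factor. Only pairs that meet survive in it, since
     [Y a] is uncorrelated with [far a]. *)
  have E2 : mean p (fun S => f' (W S)) = \sum_(a in F) \sum_(b in F | meets a b)
      mean p (fun S => Y a S * Y b S) * mean p (fun S => f' (W S)).
    under eq_bigr do rewrite -mulr_suml.
    rewrite -mulr_suml -[LHS]mul1r; congr (_ * _); rewrite -W1.
    transitivity (mean p (fun S => \sum_(a in F) Y a S * W S)).
      by apply: eq_mean => S; rewrite -mulr_suml expr2.
    rewrite mean_sum; apply: eq_bigr => a _.
    transitivity (mean p (fun S => Y a S * near a S + Y a S * far a S)).
      by apply: eq_mean => S; rewrite -mulrDr -WE.
    rewrite meanD (mean_centred_indep (farD a)) addr0 -mean_sum.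
    by apply: eq_mean => S; rewrite mulr_sumr.
  rewrite meanB E2.
  have -> : mean p (fun S => centred_sum S * f (centred_sum S)) =
     \sum_(a in F) mean p (fun S => centred a S * f (centred_sum S)).
    by rewrite -mean_sum; apply: eq_mean => S; rewrite -mulr_suml.
  rewrite -sumrB; apply: eq_bigr => a _; rewrite /T1 /T2 sumrB.
  rewrite -[X in _ = _ - X - _]mean_sum opprB addrA; congr (_ - _).
  rewrite [X in _ = _ - X + _](_ : _ =
    mean p (fun S => centred a S * near a S * f' (centred_sum S))) ?subrK //.
  by apply: eq_mean => S; rewrite -mulr_suml -mulr_sumr.
pose q a b c := p ^+ #|a :|: b :|: c|.
pose U := \sum_(a in F) \sum_(b in F | meets a b) \sum_(c in F | meets b c) q a b c.
(* Paths a - b - c are stars centred at b, so exchanging the roles of a and b turns one sum into the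
   other. *)
have UE : U = cluster_sum.
  rewrite /U /cluster_sum; under eq_bigr do rewrite big_mkcondr.
  rewrite exchange_big /=; apply: eq_bigr => a _; rewrite [RHS]big_mkcondr.
  apply: eq_bigr => b _; rewrite meetsC; case: ifP => // _.
  by apply: eq_bigr => c _; rewrite /q [b :|: a]finset.setUC.
apply: le_trans (ler_norm_sum _ _ _) _.
apply: (@le_trans _ _ (\sum_(a in F) (2 * C * (\sum_(b in F | meets a b)
  (\sum_(c in F | meets a c) q a b c + \sum_(c in F | meets b c) q a b c)) +
  C * \sum_(b in F | meets a b) \sum_(c in F | meets a c) q a b c))).
  apply: ler_sum => a _; apply: le_trans (ler_normB _ _) _.
  apply: lerD; last exact: stein_first_order.
  rewrite mulr_sumr; apply: le_trans (ler_norm_sum _ _ _) _.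
  apply: ler_sum => b _; apply: le_trans (stein_second_order _ _) _.
  rewrite ler_wpM2l ?mulr_ge0 // big_mkcondr [X in _ <= X + _]big_mkcondr.
  rewrite [X in _ <= _ + X]big_mkcondr -big_split; apply: ler_sum => c _ /=.
  have q0 : 0 <= q a b c by have /andP[? _] := p01; rewrite exprn_ge0.
  by case: (meets a c); case: (meets b c); rewrite /= ?addr0 ?add0r ?lerDl.
under eq_bigr do rewrite big_split mulrDr.
rewrite !big_split -!mulr_sumr /= -/U UE -/cluster_sum /C.
by rewrite le_eqVlt; apply/orP; left; apply/eqP; rewrite /cluster_sum /q; ring.
Qed.

End LocalDependence.

(** * The Chen-Stein bound for counts of contained sets *)

Section PoissonApproximation.
Context (R : realFieldType) (I : finType) (p : R) (F : {set {set I}}).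
Hypothesis p01 : 0 <= p <= 1.
Hypothesis F_neq0 : finset.set0 \notin F.

Let X (a S : {set I}) : nat := a \subset S.

Definition edge_count (S : {set I}) : nat := \sum_(a in F) (a \subset S).

Definition overlap_sum : R :=
  \sum_(a in F) \sum_(b in F | meets a b && (b != a)) p ^+ #|a :|: b|.

Lemma chen_stein_local (g : nat -> R) (M lambda : R) :
    (forall k, `|g k| <= M) ->
  `|mean p (fun S => lambda * g (edge_count S).+1 -
                     (edge_count S)%:R * g (edge_count S))|
  <= M * (`|lambda - (\sum_(a in F) p ^+ #|a|)| + 4 * overlap_sum +
          2 * \sum_(a in F) p ^+ (#|a| + #|a|)).
Proof.
move=> gM; have /andP[p0 p1] := p01.
have M0 : 0 <= M by apply: le_trans (gM 0%N).
pose N := edge_count; pose Q (a b : {set I}) := meets a b && (b != a).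
pose far a S := (\sum_(b in F | ~~ meets a b) X b S)%N.
have gdist i j : `|g i - g j| <= 2 * M.
  by rewrite (le_trans (ler_normB _ _)) // mulr_natl mulr2n lerD.
have gneq (i j k : nat) : (i != j -> (0 < k)%N) -> `|g i - g j| <= 2 * M * k%:R.
  have [-> _|_ /(_ isT) k0] := eqVneq i j.
    by rewrite subrr normr0 !mulr_ge0.
  by apply: le_trans (gdist _ _) _; rewrite ler_peMr ?mulr_ge0 // ler1n.
have NE a S : N S = (\sum_(b in F | meets a b) X b S + far a S)%N.
  by rewrite /N /edge_count (bigID (meets a)).
(* This is where the empty set must be excluded from F: it does not meet itself. *)
have maa a : a \in F -> meets a a.
  move=> aF; rewrite /meets -finset.setI_eq0 finset.setIid.
  by apply: contraNneq F_neq0 => <-.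
have nearE a S : a \in F -> (\sum_(b in F | meets a b) X b S =
    X a S + \sum_(b in F | Q a b) X b S)%N.
  move=> aF; rewrite (bigD1 a) ?aF ?maa //=; congr (_ + _)%N.
  by apply: eq_bigl => b; rewrite /Q andbA.
(* When a is contained in S, the count is 1 + [far a] plus the contained neighbours other than a.
   The two values of g thus differ only if such a neighbour is present; when a is not contained,
   both terms vanish. *)
have step1 a : a \in F -> `|mean p (fun S => (X a S)%:R * g (N S)) -
    p ^+ #|a| * mean p (fun S => g (far a S).+1)|
    <= 2 * M * \sum_(b in F | Q a b) p ^+ #|a :|: b|.
  move=> aF; rewrite -mean_subset.
  rewrite -(mean_indep p (V := a) (v := fun S => g (far a S).+1)); first last.
  - move=> S; congr (g _.+1); apply: eq_bigr => b /andP[_]; rewrite negbK => ab.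
    by rewrite /X finset.subsetD disjoint_sym ab andbT.
  - by move=> S; rewrite finset.subsetI fintype.subxx andbT.
  rewrite -meanB; apply: le_trans (ler_norm_mean p01 _) _.
  rewrite -(eq_bigr _ (fun b _ => mean_subset p (a :|: b))) -mean_sum -meanZl.
  apply: le_mean => // S; rewrite -mulrBr normrM.
  have [aS|aS] := boolP (a \subset S); last first.
    rewrite /X (negPf aS) normr0 mul0r !mulr_ge0 //.
    by apply: sumr_ge0 => b _.
  rewrite /X aS normr1 mul1r -natr_sum; apply: gneq.
  rewrite (NE a) nearE // /X aS add1n addSn eqSS => Nfar.
  rewrite (eq_bigr (X^~ S)) => [|b _]; last by rewrite finset.subUset aS.
  by rewrite lt0n; apply: contra Nfar => /eqP ->.
(* Here nothing is assumed on a, so a itself counts as a neighbour; this produces the terms p^(2|a|)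
   of the final bound. *)
have step2 a : `|mean p (fun S => g (far a S).+1) - mean p (fun S => g (N S).+1)|
    <= 2 * M * \sum_(b in F | meets a b) p ^+ #|b|.
  rewrite -meanB; apply: le_trans (ler_norm_mean p01 _) _.
  rewrite -(eq_bigr _ (fun b _ => mean_subset p b)) -mean_sum -meanZl.
  apply: le_mean => // S; rewrite -natr_sum; apply: gneq.
  rewrite (NE a) eqSS lt0n; apply: contra => /eqP near0.
  by rewrite -[X in _ == (X + _)%N]/(\sum_(b in F | meets a b) X b S)%N near0.
have step a : a \in F -> `|mean p (fun S => (X a S)%:R * g (N S)) -
    p ^+ #|a| * mean p (fun S => g (N S).+1)|
    <= M * (4 * \sum_(b in F | Q a b) p ^+ #|a :|: b| + 2 * p ^+ (#|a| + #|a|)).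
  move=> aF; rewrite -(subrK (p ^+ #|a| * mean p (fun S => g (far a S).+1))
    (mean p (fun S => (X a S)%:R * g (N S)))) -addrA -mulrBr.
  apply: le_trans (ler_normD _ _) _.
  apply: le_trans (lerD (step1 _ aF) _) _; first exact: lexx.
  rewrite normrM ger0_norm ?exprn_ge0 //.
  apply: le_trans (lerD (lexx _) (ler_wpM2l _ (step2 a))) _; rewrite ?exprn_ge0 //.
  have -> : \sum_(b in F | meets a b) p ^+ #|b| =
      p ^+ #|a| + \sum_(b in F | Q a b) p ^+ #|b|.
    rewrite (bigD1 a) ?aF ?maa //=; congr (_ + _).
    by apply: eq_bigl => b; rewrite /Q andbA.
  have le_u : p ^+ #|a| * (\sum_(b in F | Q a b) p ^+ #|b|) <=
      \sum_(b in F | Q a b) p ^+ #|a :|: b|.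
    rewrite mulr_sumr; apply: ler_sum => b _; rewrite -exprD.
    by apply: ler_wiXn2l => //; exact: leq_card_setU.
  rewrite exprD; move: le_u.
  move: (p ^+ #|a|) (\sum_(b in F | Q a b) p ^+ #|b|).
  move: (\sum_(b in F | Q a b) p ^+ #|a :|: b|) => w t u le_u.
  by have := ler_wpM2l M0 le_u; lra.
rewrite meanB meanZl.
have -> : mean p (fun S => (edge_count S)%:R * g (edge_count S)) =
    \sum_(a in F) mean p (fun S => (X a S)%:R * g (N S)).
  rewrite -mean_sum; apply: eq_mean => S.
  by rewrite /edge_count natr_sum mulr_suml.
set G := mean p (fun S => g (edge_count S).+1).
set m := \sum_(a in F) p ^+ #|a|.
rewrite -(subrK (m * G) (lambda * G)) -mulrBl -addrA.
apply: le_trans (ler_normD _ _) _; rewrite -addrA mulrDr; apply: lerD.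
  rewrite normrM mulrC ler_wpM2r //; apply: le_trans (ler_norm_mean p01 _) _.
  by rewrite -[leRHS](mean_cst I p); apply: le_mean.
rewrite distrC /m mulr_suml -sumrB; apply: le_trans (ler_norm_sum _ _ _) _.
rewrite /overlap_sum !mulr_sumr -big_split mulr_sumr /=.
by apply: ler_sum => a aF; exact: step.
Qed.

End PoissonApproximation.

(** * Poisson approximation *)

Lemma leq_factM m n : (m`! * n`! <= (m + n)`!)%N.
Proof.
rewrite -(bin_fact (leq_addr n m)) addKn leq_pmull //.
by rewrite bin_gt0 leq_addr.
Qed.

(** Termwise, x^(k+1+i) / (k+1+i)! is at most x^(k+1) / k! times x^i / i!, because k! i! <= (k+i)!.
    Dividing by k! rather than (k+1)! matches the denominator of the Stein solution. *)
Lemma expR_tail_le (R : realType) (x : R) k : 0 <= x ->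
  expR x - \sum_(0 <= j < k.+1) x ^+ j / j`!%:R <= expR x * (x ^+ k.+1 / k`!%:R).
Proof.
move=> x0; rewrite lerBlDl; apply: limr_le; first exact: is_cvg_series_exp_coeff.
have c0 n : 0 <= x ^+ n / n`!%:R by rewrite divr_ge0 ?exprn_ge0.
have nd : {homo series (exp_coeff x) : m n / (m <= n)%N >-> m <= n}.
  by apply: nondecreasing_series => n _ _; exact: c0.
near=> n; apply: (@le_trans _ _ (series (exp_coeff x) (k.+1 + n)%N)).
  by apply: nd; exact: leq_addl.
rewrite /series /= (@big_cat_nat _ _ _ k.+1) ?leq_addr //= lerD2l.
rewrite -[X in \sum_(X <= _ < _) _]add0n big_addn addKn.
apply: (@le_trans _ _ (x ^+ k.+1 / k`!%:R * \sum_(0 <= i < n) exp_coeff x i)).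
  rewrite mulr_sumr; apply: ler_sum => i _.
  rewrite /exp_coeff /= exprD mulrACA [x ^+ i * _]mulrC.
  rewrite ler_wpM2l ?mulr_ge0 ?exprn_ge0 //.
  rewrite -invfM lef_pV2 ?posrE ?mulr_gt0 ?ltr0n ?fact_gt0 //.
  rewrite -natrM ler_nat (leq_trans (leq_factM _ _)) // addnS factS addnC.
  by rewrite leq_pmull.
rewrite mulrC ler_wpM2r ?divr_ge0 ?exprn_ge0 //.
exact: (nondecreasing_cvgn_le nd (is_cvg_series_exp_coeff x) n).
Unshelve. all: by end_near.
Qed.

Section PoissonStein.
Context (R : realType) (lambda : R).
Hypothesis lambda_gt0 : 0 < lambda.

Let pmf := poisson_pmf lambda.

Let pmf_gt0 k : 0 < pmf k.
Proof.
by rewrite /pmf /poisson_pmf lambda_gt0 mulr_gt0 ?expR_gt0 ?divr_gt0 ?exprn_gt0 ?ltr0n ?fact_gt0.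
Qed.

Let pmfS k : k.+1%:R * pmf k.+1 = lambda * pmf k.
Proof.
have k0 : k.+1%:R != 0 :> R by rewrite pnatr_eq0.
rewrite /pmf /poisson_pmf lambda_gt0 factS natrM exprS invfM.
by rewrite -!mulrA [k.+1%:R * _]mulrCA; congr (_ * _); rewrite mulrCA mulVKf.
Qed.

Let tail k : 1 - \sum_(0 <= j < k.+1) pmf j <= expR lambda * (lambda * pmf k).
Proof.
have -> : \sum_(0 <= j < k.+1) pmf j =
  expR (- lambda) * \sum_(0 <= j < k.+1) lambda ^+ j / j`!%:R.
  rewrite mulr_sumr; apply: eq_bigr => j _.
  by rewrite /pmf /poisson_pmf lambda_gt0 mulrC.
rewrite -{1}(expRxMexpNx_1 lambda) [X in X - _]mulrC -mulrBr /pmf /poisson_pmf lambda_gt0.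
have -> : expR lambda * (lambda * (lambda ^+ k / k`!%:R * expR (- lambda)))
  = expR (- lambda) * (expR lambda * (lambda ^+ k.+1 / k`!%:R)).
  by rewrite exprS; ring.
by rewrite ler_wpM2l ?expR_ge0 // expR_tail_le // ltW.
Qed.

(* The hypothesis on c says that it is the mass of h for the Poisson law. *)
Lemma poisson_stein_solution (h : pred nat) (c : R) :
    (forall m, \sum_(0 <= j < m) (h j)%:R * pmf j <= c <=
       \sum_(0 <= j < m) (h j)%:R * pmf j + (1 - \sum_(0 <= j < m) pmf j)) ->
  exists2 g : nat -> R, (forall k, `|g k| <= expR lambda) &
    forall k, lambda * g k.+1 - k%:R * g k = (h k)%:R - c.
Proof.
move=> hc; pose D k := \sum_(0 <= j < k) ((h j)%:R - c) * pmf j.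
(* Forward solution of the recursion. Its value at 0 is 0 by the convention x / 0 = 0, and the
   equation at 0 multiplies that value by 0. *)
exists (fun k => D k / (k%:R * pmf k)) => [[|k]|k].
- by rewrite mul0r invr0 mulr0 normr0 expR_ge0.
- rewrite pmfS normrM normfV [`|lambda * _|]gtr0_norm ?mulr_gt0 //.
  rewrite ler_pdivrMr ?mulr_gt0 //; apply: le_trans (tail k).
  (* With A and s the partial masses of [h] and of the law, A <= c <= A + (1 - s) and 0 <= A <= s
     give |A - c s| <= 1 - s, the tail that has just been bounded. *)
  have /andP[] := hc k.+1; rewrite /D.
  under [X in _ -> _ -> `|X| <= _]eq_bigr do rewrite mulrBl.
  rewrite sumrB -mulr_sumr.
  have : 0 <= \sum_(0 <= j < k.+1) (h j)%:R * pmf j <= \sum_(0 <= j < k.+1) pmf j.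
    apply/andP; split; first by apply: sumr_ge0 => j _; rewrite mulr_ge0 // ltW.
    by apply: ler_sum => j _; case: (h j); rewrite ?mul1r ?mul0r // ltW.
  have /andP[c0 c1] : 0 <= c <= 1.
    by have := hc 0%N; rewrite !big_nil subr0 add0r.
  have : \sum_(0 <= j < k.+1) pmf j <= 1.
    by have /andP[l1 l2] := hc k.+1; have := le_trans l1 l2; rewrite lerDl subr_ge0.
  move: (\sum_(0 <= j < k.+1) (h j)%:R * pmf j) => A.
  move: (\sum_(0 <= j < k.+1) pmf j) => s s1 /andP[A0 As] Ac cA.
  by rewrite ler_norml; apply/andP; split; nra.
have -> : D k.+1 = D k + ((h k)%:R - c) * pmf k by rewrite /D big_nat_recr.
have [pk l0] : pmf k != 0 /\ lambda != 0 by rewrite !gt_eqF.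
rewrite pmfS; case: k pk => [|k] pk.
  by rewrite {1}/D big_geq // mul0r subr0 add0r; field; rewrite pk.
have k0 : k.+1%:R != 0 :> R by rewrite pnatr_eq0.
move: (k.+1%:R) k0 (pmf k.+1) pk (D k.+1) => a a0 b b0 e.
by field; rewrite a0 b0.
Qed.

End PoissonStein.

Lemma poisson_prob_set1 (R : realType) (lambda : R) k : 0 < lambda ->
  poisson_prob lambda 0 [set k] = (poisson_pmf lambda k)%:E.
Proof.
by move=> l0; rewrite /poisson_prob l0 esum_set1 // lee_fin poisson_pmf_ge0.
Qed.

Lemma poisson_prob_ge_sum (R : realType) (lambda : R) (h : pred nat) m : 0 < lambda ->
  \sum_(0 <= j < m) (h j)%:R * poisson_pmf lambda j
    <= fine (poisson_prob lambda 0 [set k | h k]).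
Proof.
move=> l0; pose Q : probability nat R := poisson_prob lambda 0.
rewrite -lee_fin fineK; last exact: (fin_num_measure Q).
pose B j := if h j then [set j] else set0 : set nat.
have trivB : trivIset setT B.
  apply/trivIsetP => i j _ _ ij; rewrite /B.
  case: (h i); case: (h j); rewrite ?set0I ?setI0 //.
  by apply/seteqP; split=> k //= [-> /eqP]; rewrite (negPf ij).
rewrite big_mkord (_ : (_%:E) = Q (\big[setU/set0]_(j < m) B j)).
  apply: (@le_measure _ _ _ Q); rewrite ?inE //.
  by rewrite -bigcup_mkord => k [j _]; rewrite /B; case: ifP => //= hj ->.
rewrite measure_bigsetU // -sumEFin; apply: eq_bigr => j _.
rewrite /B; case: (h j); last by rewrite measure0 mul0r.
by rewrite mul1r; exact/esym/poisson_prob_set1.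
Qed.

(** The upper bound is the lower bound for the complementary event. *)
Lemma poisson_prob_bounds (R : realType) (lambda : R) (h : pred nat) m : 0 < lambda ->
  \sum_(0 <= j < m) (h j)%:R * poisson_pmf lambda j
   <= fine (poisson_prob lambda 0 [set k | h k])
   <= \sum_(0 <= j < m) (h j)%:R * poisson_pmf lambda j +
      (1 - \sum_(0 <= j < m) poisson_pmf lambda j).
Proof.
move=> l0; rewrite poisson_prob_ge_sum //=.
pose Q : probability nat R := poisson_prob lambda 0.
have := poisson_prob_ge_sum (predC h) m l0.
have -> : [set k | predC h k] = ~` [set k | h k].
  by apply/seteqP; split=> k /= /negP.
have -> : poisson_prob lambda 0 (~` [set k | h k]) =
    (1 - poisson_prob lambda 0 [set k | h k])%E.
  exact: (probability_setC Q).
rewrite fineB //; last exact: (fin_num_measure Q).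
have -> : \sum_(0 <= j < m) (predC h j)%:R * poisson_pmf lambda j =
  \sum_(0 <= j < m) poisson_pmf lambda j -
  \sum_(0 <= j < m) (h j)%:R * poisson_pmf lambda j.
  rewrite -sumrB; apply: eq_bigr => j _ /=.
  by case: (h j); rewrite ?mul1r ?mul0r ?subrr ?subr0.
by rewrite /=; lra.
Qed.

Lemma poisson_approximation (R : realType) (I : finType) (p lambda : R)
    (F : {set {set I}}) (h : pred nat) :
    0 <= p <= 1 -> finset.set0 \notin F -> 0 < lambda ->
  `|mean p (fun S => (h (edge_count F S))%:R) -
    fine (poisson_prob lambda 0 [set k | h k])|
  <= expR lambda * (`|lambda - (\sum_(a in F) p ^+ #|a|)| + 4 * overlap_sum p F +
                    2 * \sum_(a in F) p ^+ (#|a| + #|a|)).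
Proof.
move=> p01 F0 l0.
have [g gM gE] := poisson_stein_solution l0 (fun m => poisson_prob_bounds h m l0).
have := chen_stein_local p01 F0 lambda gM.
rewrite (eq_mean p (fun S => gE (edge_count F S))).
by rewrite meanB mean_cst.
Qed.

(** * Uniform hypergraphs *)

Lemma leq_card_bigcup (J T : finType) (A : {set T}) (Q : pred J) (B : J -> {set T}) :
    (forall c, c \in A -> exists2 j, Q j & c \in B j) ->
  (#|A| <= \sum_(j | Q j) #|B j|)%N.
Proof.
move=> AB; apply: (@leq_trans #|\bigcup_(j | Q j) B j|).
  apply/subset_leq_card/fintype.subsetP => c /AB[j Qj cj].
  by apply/finset.bigcupP; exists j.
elim/big_ind2: _ => [|m A1 n A2 h1 h2|//]; first by rewrite cards0.
by apply: leq_trans (leq_card_setU _ _) _; exact: leq_add.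
Qed.

Section UniformHypergraph.
Context (R : realFieldType) (I : finType) (p q : R) (F : {set {set I}}).
Context (l deg codeg : nat) (beta : R).
Hypothesis q01 : 0 <= q <= 1.
Hypothesis pE : p = q ^+ 2.
Hypothesis F_card : forall a, a \in F -> #|a| = l.
Hypothesis F_deg : forall x, (#|[set a in F | x \in a]%SET| <= deg)%N.
Hypothesis F_codeg : forall x y, x != y ->
  (#|[set a in F | (x \in a) && (y \in a)]%SET| <= codeg)%N.
Hypothesis F_overlap : forall a, a \in F ->
  \sum_(b in F | (b != a) && (1 < #|a :&: b|)%N) q ^+ (l - #|a :&: b|) <= beta.
Implicit Types (a b c V : {set I}).

(** At most [l * deg] edges meet a given edge, and one that meets it in a single point has l - 1
    points of its own. So D bounds the expected number of such edges once the given one is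
    present. *)
Let D : R := (l * deg)%:R * p ^+ l.-1.

Let p01 : 0 <= p <= 1.
Proof. by rewrite pE sqr_ge0 expr_le1 //; case/andP: q01. Qed.

Let p_ge0 : 0 <= p. Proof. by case/andP: p01. Qed.

Let leXp m k : (k <= m)%N -> p ^+ m <= p ^+ k.
Proof. by move=> km; have /andP[p0 p1] := p01; apply: ler_wiXn2l. Qed.

Lemma meets_card a b : meets a b = (0 < #|a :&: b|)%N.
Proof. by rewrite /meets -finset.setI_eq0 card_gt0. Qed.

Lemma card_meets_le a : a \in F -> (#|[set b in F | meets a b]%SET| <= l * deg)%N.
Proof.
move=> aF; rewrite -(F_card aF) -sum_nat_const.
apply: (@leq_trans (\sum_(x in a) #|[set b in F | x \in b]%SET|)).
  apply: leq_card_bigcup => b.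
  rewrite inE meets_card card_gt0 => /andP[bF /finset.set0Pn[x]].
  by rewrite !inE => /andP[xa xb]; exists x; rewrite ?inE ?bF.
by apply: leq_sum => x _.
Qed.

Lemma card_overlap_le V :
  (#|[set c in F | (1 < #|V :&: c|)%N]%SET| <= #|V| ^ 2 * codeg)%N.
Proof.
rewrite -mulnn -cardsX -sum_nat_const.
apply: (@leq_trans (\sum_(z in finset.setX V V | z.1 != z.2)
    #|[set c in F | (z.1 \in c) && (z.2 \in c)]%SET|)).
  apply: leq_card_bigcup => c; rewrite inE => /andP[cF /card_gt1P[x [y [+ + xy]]]].
  rewrite !inE => /andP[xV xc] /andP[yV yc].
  by exists (x, y); rewrite !inE /= ?xV ?yV ?xc ?yc ?cF.
rewrite big_mkcondr /=; apply: leq_sum => z _; case: ifP => //.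
exact: F_codeg.
Qed.

Lemma F_overlap1 a : a \in F ->
  \sum_(b in F | (1 < #|a :&: b|)%N) q ^+ (l - #|a :&: b|) <= 1 + beta.
Proof.
move=> aF; have [l1|l1] := boolP (1 < #|a :&: a|)%N; last first.
  apply: ler_wpDl => //; apply: le_trans (F_overlap aF).
  rewrite big_mkcondr [leRHS]big_mkcondr; apply: ler_sum => b _.
  by case: eqVneq => [->|//]; rewrite (negPf l1).
rewrite (bigD1 a) ?aF //= finset.setIid F_card // subnn expr0 lerD2l.
apply: le_trans (F_overlap aF); rewrite le_eqVlt; apply/orP; left; apply/eqP.
by apply: eq_bigl => b; rewrite -andbA [(_ < _)%N && _]andbC.
Qed.

Let sum_near a (G : {set I} -> R) : \sum_(b in F | meets a b) G b =
  \sum_(b in F | #|a :&: b| == 1%N) G b + \sum_(b in F | (1 < #|a :&: b|)%N) G b.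
Proof.
rewrite (bigID (fun b => #|a :&: b| == 1%N)) /=; congr (_ + _); apply: eq_bigl => b;
by rewrite -andbA meets_card; case: #|_| => [|[|k]].
Qed.

(** Pairs (b, c) are split according to whether one of them meets a in exactly one point. The weight
    is symmetric in b and c, so this case is counted as [2 * M1]; in the other case the sum
    factorises. *)
Lemma cluster_sum_le : (0 < l)%N ->
  cluster_sum p F <=
  #|F|%:R * (p ^+ l * (2 * (D * (D + (4 * l ^ 2 * codeg)%:R)) + (1 + beta) ^+ 2)).
Proof.
move=> l0; rewrite mulr_natl -sumr_const; apply: ler_sum => a aF.
have al := F_card aF; have /andP[q0 q1] := q01.
pose g b c := p ^+ #|a :|: b :|: c|.
have gC b c : g b c = g c b by rewrite /g finset.setUAC.
have g0 b c : 0 <= g b c by rewrite exprn_ge0.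
have inner b : b \in F -> #|a :&: b| = 1%N ->
    \sum_(c in F | meets a c) g b c <= p ^+ (l + l.-1) * (D + (4 * l ^ 2 * codeg)%:R).
  move=> bF ab; pose V := a :|: b.
  have cV : #|V| = (l + l.-1)%N by rewrite cardsU al F_card // ab; lia.
  apply: (@le_trans _ _ (\sum_(c in F | meets a c) p ^+ (l + l.-1) *
      (p ^+ l.-1 + (1 < #|V :&: c|)%N%:R))).
    apply: ler_sum => c /andP[cF _]; rewrite /g -/V.
    have cVc : #|V :|: c| = (l + l.-1 + l - #|V :&: c|)%N by rewrite cardsU cV F_card.
    (* If c has at most one point in V, it adds at least l - 1 new points. Otherwise no gain is
       claimed, and such c are counted by the codegree, with |V| <= 2 l. *)
    case: leqP => Vc; first by rewrite addr0 -exprD leXp //; lia.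
    apply: (@le_trans _ _ (p ^+ (l + l.-1))).
      by rewrite -cV leXp // subset_leq_card // finset.subsetUl.
    by rewrite ler_peMr ?exprn_ge0 // lerDr exprn_ge0.
  rewrite -mulr_sumr ler_wpM2l ?exprn_ge0 // big_split /=; apply: lerD.
    rewrite sumr_const -mulr_natl ler_wpM2r ?exprn_ge0 // ler_nat.
    by apply: leq_trans (card_meets_le aF); rewrite cardsE.
  rewrite -natr_sum ler_nat big_mkcondr /=.
  apply: (@leq_trans #|[set c in F | (1 < #|V :&: c|)%N]%SET|).
    rewrite -sum1dep_card [leqRHS]big_mkcondr; apply: leq_sum => c _.
    by case: ifP => // _; case: (_ < _)%N.
  apply: leq_trans (card_overlap_le _) _; rewrite cV leq_mul2r; nia.
(* In powers of q the exponent on the left is 2 |a u b u c| >= |a u b| + |a u c|. *)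
have rest b c : b \in F -> c \in F ->
    g b c <= p ^+ l * (q ^+ (l - #|a :&: b|) * q ^+ (l - #|a :&: c|)).
  move=> bF cF; rewrite /g pE -!exprM -!exprD; apply: ler_wiXn2l => //.
  have ab := cardsU a b; have ac := cardsU a c.
  rewrite al (F_card bF) in ab; rewrite al (F_card cF) in ac.
  have ib : (#|a :&: b| <= l)%N by rewrite -al subset_leq_card // finset.subsetIl.
  have ic : (#|a :&: c| <= l)%N by rewrite -al subset_leq_card // finset.subsetIl.
  have le1 : (#|a :|: b| <= #|a :|: b :|: c|)%N by rewrite subset_leq_card // finset.subsetUl.
  have le2 : (#|a :|: c| <= #|a :|: b :|: c|)%N.
    by rewrite subset_leq_card // finset.setUAC finset.subsetUl.
  lia.
pose M1 := \sum_(b in F | #|a :&: b| == 1%N) \sum_(c in F | meets a c) g b c.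
apply: (@le_trans _ _ (2 * M1 + \sum_(b in F | (1 < #|a :&: b|)%N)
    \sum_(c in F | (1 < #|a :&: c|)%N) g b c)).
  rewrite sum_near mulr_natl mulr2n -addrA lerD2l.
  have -> : M1 = \sum_(b in F | meets a b) \sum_(c in F | #|a :&: c| == 1%N) g b c.
    by rewrite /M1 exchange_big; apply: eq_bigr => c _; apply: eq_bigr => b _.
  rewrite [X in _ <= X + _]sum_near -addrA ler_wpDl //.
    by apply: sumr_ge0 => b _; apply: sumr_ge0.
  by rewrite -big_split; apply: ler_sum => b _; rewrite sum_near.
rewrite [leRHS]mulrDr; apply: lerD.
  rewrite mulrCA ler_wpM2l //.
  apply: (@le_trans _ _ (\sum_(b in F | #|a :&: b| == 1%N)
      p ^+ (l + l.-1) * (D + (4 * l ^ 2 * codeg)%:R))).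
    by apply: ler_sum => b /andP[bF /eqP ab]; exact: inner.
  have DE : p ^+ l * (D * (D + (4 * l ^ 2 * codeg)%:R)) =
      (l * deg)%:R * (p ^+ (l + l.-1) * (D + (4 * l ^ 2 * codeg)%:R)).
    by rewrite exprD /D; ring.
  rewrite DE sumr_const -[leLHS]mulr_natl ler_wpM2r //.
    by rewrite mulr_ge0 ?exprn_ge0 // addr_ge0 // mulr_ge0 ?exprn_ge0.
  rewrite ler_nat; apply: leq_trans (card_meets_le aF).
  apply/subset_leq_card/fintype.subsetP => b; rewrite !inE => /andP[-> /eqP ab].
  by rewrite meets_card ab.
apply: (@le_trans _ _ (p ^+ l * (\sum_(b in F | (1 < #|a :&: b|)%N)
     q ^+ (l - #|a :&: b|)) ^+ 2)).
  rewrite expr2 mulr_suml mulr_sumr; apply: ler_sum => b /andP[bF _].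
  by rewrite !mulr_sumr; apply: ler_sum => c /andP[cF _]; exact: rest.
rewrite ler_wpM2l ?exprn_ge0 // ler_sqr ?nnegrE ?F_overlap1 //.
  by apply: sumr_ge0 => b _; rewrite exprn_ge0.
by apply: le_trans (F_overlap1 aF); apply: sumr_ge0 => b _; rewrite exprn_ge0.
Qed.

Lemma overlap_sum_le : (0 < l)%N ->
  overlap_sum p F <= #|F|%:R * (p ^+ l * (D + beta)).
Proof.
move=> l0; rewrite mulr_natl -sumr_const; apply: ler_sum => a aF.
have al := F_card aF; have /andP[q0 q1] := q01.
have qp : p <= q by rewrite pE expr2 ler_piMl.
apply: (@le_trans _ _ (\sum_(b in F) p ^+ l *
    ((meets a b)%:R * p ^+ l.-1 +
     if (b != a) && (1 < #|a :&: b|)%N then q ^+ (l - #|a :&: b|) else 0))).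
  rewrite big_mkcondr; apply: ler_sum => b bF.
  have bl := F_card bF; have := cardsU a b; rewrite al bl meets_card => ab.
  have ib : (#|a :&: b| <= l)%N by rewrite -al subset_leq_card // finset.subsetIl.
  have pos x y : 0 <= p ^+ l * (x%:R * p ^+ l.-1 + if y then q ^+ (l - #|a :&: b|) else 0).
    by rewrite mulr_ge0 ?addr_ge0 ?mulr_ge0 ?exprn_ge0 //; case: y; rewrite ?exprn_ge0.
  case: ifP => [/andP[mab ba]|_]; last exact: pos.
  rewrite mab ba mul1r ab /=; case: ifP => k1; last first.
    by rewrite addr0 -exprD leXp //; lia.
  rewrite -addnBA // exprD ler_wpM2l ?exprn_ge0 //.
  by rewrite ler_wpDl ?exprn_ge0 // lerXn2r.
rewrite -mulr_sumr ler_wpM2l ?exprn_ge0 // big_split /=; apply: lerD.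
  rewrite -mulr_suml ler_wpM2r ?exprn_ge0 // -natr_sum ler_nat.
  by apply: leq_trans (card_meets_le aF); rewrite -sum1dep_card [leqRHS]big_mkcondr.
by rewrite -big_mkcondr F_overlap.
Qed.

End UniformHypergraph.

(** * Lower bounds for the variance of an edge count *)

Lemma sqr_sum_le (R : realFieldType) (J : finType) (x : J -> R) :
  (\sum_j x j) ^+ 2 <= #|J|%:R * \sum_j x j ^+ 2.
Proof.
have [J0|J0] := posnP #|J|.
  by rewrite big_pred0 ?expr0n /= ?J0 ?mul0r // => j; have := card0_eq J0 j.
set n : R := #|J|%:R; have n0 : 0 < n by rewrite ltr0n.
pose m := (\sum_j x j) / n.
have : 0 <= \sum_j (x j - m) ^+ 2 by apply: sumr_ge0 => j _; exact: sqr_ge0.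
have -> : \sum_j (x j - m) ^+ 2 = \sum_j x j ^+ 2 - 2 * m * (\sum_j x j) + n * m ^+ 2.
  under eq_bigr do rewrite sqrrB.
  rewrite big_split sumrB /= sumr_const -[m ^+ 2 *+ _]mulr_natl; congr (_ - _ + _).
  by rewrite mulr_sumr; apply: eq_bigr => j _; rewrite -mulr_natl; ring.
have mn : m * n = \sum_j x j by rewrite mulfVK ?gt_eqF.
clearbody m; rewrite -mn; move: (\sum_j x j ^+ 2) => z; nra.
Qed.

Section HypergraphVariance.
Context (R : realFieldType) (I : finType) (p : R) (F : {set {set I}}) (l : nat).
Hypothesis p01 : 0 < p <= 1.
Hypothesis F_card : forall a, a \in F -> #|a| = l.
Hypothesis l_gt0 : (0 < l)%N.

Definition count_var : R := mean p (fun S => centred_sum p 1 F S ^+ 2).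

Let p_ge0 : 0 <= p. Proof. by case/andP: p01 => /ltW. Qed.
Let p_le1 : p <= 1. Proof. by case/andP: p01. Qed.

Lemma count_varE :
  count_var = \sum_(a in F) \sum_(b in F) (p ^+ #|a :|: b| - p ^+ (l + l)).
Proof.
rewrite /count_var.
transitivity (mean p (fun S => \sum_(a in F) \sum_(b in F) centred p 1 a S * centred p 1 b S)).
  by apply: eq_mean => S; rewrite expr2 mulr_suml; apply: eq_bigr => a _; rewrite mulr_sumr.
rewrite mean_sum; apply: eq_bigr => a aF; rewrite mean_sum; apply: eq_bigr => b bF.
transitivity (mean p (fun S => ((a :|: b) \subset S)%:R - p ^+ l * (a \subset S)%:R
   - p ^+ l * (b \subset S)%:R + p ^+ (l + l))).
  apply: eq_mean => S; rewrite /centred (F_card aF) (F_card bF) finset.subUset -mulnb natrM exprD.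
  by ring.
by rewrite meanD !meanB !meanZl !mean_subset mean_cst (F_card aF) (F_card bF) exprD; ring.
Qed.

(** With k = |a n b|, the difference telescopes into k terms p^j (1 - p) with j <= 2 l - 1. *)
Let term_ge a b : a \in F -> b \in F ->
  #|a :&: b|%:R * (p ^+ (l + l.-1) * (1 - p)) <= p ^+ #|a :|: b| - p ^+ (l + l).
Proof.
move=> aF bF; have ab := cardsU a b; rewrite (F_card aF) (F_card bF) in ab.
have ib : (#|a :&: b| <= l)%N by rewrite -(F_card aF) subset_leq_card // finset.subsetIl.
rewrite ab; move: (#|a :&: b|) ib => k kl.
elim: k kl => [|k IH] kl; first by rewrite mul0r subn0 subrr.
have {}IH := IH (ltnW kl).
have E : (l + l - k = (l + l - k.+1).+1)%N by lia.
rewrite E in IH; rewrite -natr1 mulrDl mul1r.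
have : p ^+ (l + l.-1) <= p ^+ (l + l - k.+1) by apply: ler_wiXn2l => //; lia.
have q0 : 0 <= 1 - p by rewrite subr_ge0.
by move=> /(ler_wpM2r q0); move: IH; rewrite exprS; lra.
Qed.

Let term_ge0 a b : a \in F -> b \in F -> 0 <= p ^+ #|a :|: b| - p ^+ (l + l).
Proof.
by move=> aF bF; apply: le_trans (term_ge aF bF); rewrite !mulr_ge0 ?exprn_ge0 ?subr_ge0.
Qed.

Lemma count_var_ge_diag : #|F|%:R * (p ^+ l * (1 - p ^+ l)) <= count_var.
Proof.
rewrite count_varE mulr_natl -sumr_const; apply: ler_sum => a aF.
rewrite (bigD1 a) //= finset.setUid F_card // exprD mulrBr mulr1 lerDl.
by apply: sumr_ge0 => b /andP[bF _]; rewrite -exprD term_ge0.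
Qed.

(** The sum of the squared degrees times p^(2l-1) (1 - p) is the variance of the projection of the
    count onto linear functions of the indicators of points. Cauchy-Schwarz bounds that sum below
    through the total degree |F| l. *)
Lemma count_var_ge_proj :
  (#|F| * l)%:R ^+ 2 * (p ^+ (l + l.-1) * (1 - p)) <= #|I|%:R * count_var.
Proof.
pose dg (x : I) : R := \sum_(a in F) (x \in a)%:R.
have dgE : \sum_x dg x = (#|F| * l)%:R.
  rewrite exchange_big /= natrM mulr_natl -sumr_const; apply: eq_bigr => a aF.
  by rewrite -natr_sum -big_mkcond sum1_card F_card.
have dg2 : \sum_x dg x ^+ 2 = \sum_(a in F) \sum_(b in F) #|a :&: b|%:R.
  transitivity (\sum_x \sum_(a in F) \sum_(b in F) (x \in a :&: b)%:R : R).
    apply: eq_bigr => x _; rewrite expr2 mulr_suml; apply: eq_bigr => a _.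
    by rewrite mulr_sumr; apply: eq_bigr => b _; rewrite inE -mulnb natrM.
  rewrite exchange_big; apply: eq_bigr => a _; rewrite exchange_big.
  by apply: eq_bigr => b _; rewrite -natr_sum -big_mkcond sum1_card.
have c0 : 0 <= p ^+ (l + l.-1) * (1 - p) by rewrite mulr_ge0 ?exprn_ge0 ?subr_ge0.
rewrite -dgE; apply: le_trans (ler_wpM2r c0 (sqr_sum_le dg)) _.
rewrite -mulrA ler_wpM2l // dg2 count_varE mulr_suml; apply: ler_sum => a aF.
by rewrite mulr_suml; apply: ler_sum => b bF; exact: term_ge.
Qed.

End HypergraphVariance.

(** * Arithmetic progressions *)

Section ArithmeticProgressions.
Context (n l : nat).
Hypothesis l_ge2 : (1 < l)%N.

Definition progression (a b : nat) : {set 'I_n} :=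
  [set k : 'I_n | [exists i : 'I_l, k.+1 == (a + i * b)%N]]%SET.

Definition in_range (a b : nat) := [&& (0 < a)%N, (0 < b)%N & (a + l.-1 * b <= n)%N].

Lemma progressionP a b (k : 'I_n) :
  reflect (exists2 i, (i < l)%N & k.+1 = (a + i * b)%N) (k \in progression a b).
Proof.
rewrite inE; apply: (iffP existsP) => [[i /eqP ki]|[i il ki]]; first by exists i.
by exists (Ordinal il); apply/eqP.
Qed.

Lemma APsP S :
  reflect (exists a b, in_range a b /\ S = progression a b) (S \in APs n l).
Proof.
rewrite inE; apply: (iffP idP) => [/asboolP[a [b [b0 ab Sab]]]|[a [b [/and3P[a0 b0 ab] ->]]]].
  exists a, b; split; last by apply/setP => k; rewrite Sab inE.
  have /andP[+ _] := ab 0%N (ltnW l_ge2); rewrite mul0n addn0 => a0.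
  have /andP[_ ab1] : (1 <= a + l.-1 * b <= n)%N by apply: ab; lia.
  by apply/and3P.
apply/asboolP; exists a, b; split=> // [i il|k]; last by rewrite inE.
have : (i * b <= l.-1 * b)%N by rewrite leq_mul2r; lia.
lia.
Qed.

Lemma mem_progression a b i : in_range a b -> (i < l)%N ->
  exists2 k : 'I_n, k.+1 = (a + i * b)%N & k \in progression a b.
Proof.
move=> /and3P[a0 b0 ab] il.
have ib : (i * b <= l.-1 * b)%N by rewrite leq_mul2r; lia.
have kn : ((a + i * b).-1 < n)%N by lia.
have kE : (Ordinal kn).+1 = (a + i * b)%N by rewrite /=; lia.
by exists (Ordinal kn) => //; apply/progressionP; exists i.
Qed.

Lemma card_progression a b : in_range a b -> #|progression a b| = l.
Proof.
move=> abr; have /and3P[a0 b0 ab] := abr.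
have f_ex (i : 'I_l) := mem_progression abr (ltn_ord i).
pose f i := projT1 (cid2 (f_ex i)).
have fE i : (f i).+1 = (a + i * b)%N by rewrite /f; case: cid2.
have fin i : f i \in progression a b by rewrite /f; case: cid2.
have f_inj : injective f.
  move=> i j fij; apply: val_inj => /=; have := fE i; rewrite fij fE.
  by move=> /addnI /eqP; rewrite eqn_mul2r (gtn_eqF b0) => /eqP.
rewrite -[RHS]card_ord -(card_imset _ f_inj); apply: eq_card => k.
apply/progressionP/imsetP => [[i il ki]|[i _ ->]].
  by exists (Ordinal il) => //; apply: val_inj; have := fE (Ordinal il); rewrite -ki => -[].
by exists i.
Qed.

Lemma progression_inj a b a' b' : in_range a b -> in_range a' b' ->
  progression a b = progression a' b' -> a = a' /\ b = b'.
Proof.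
have le1 x y x' y' : in_range x y -> in_range x' y' ->
    progression x y = progression x' y' -> (x' <= x)%N.
  move=> r r' E; have [k kx] := mem_progression r (ltnW l_ge2).
  by rewrite E => /progressionP[i _ ki]; lia.
move=> r r' E; have aa : a = a'.
  by apply/eqP; rewrite eqn_leq (le1 _ _ _ _ r r' E) (le1 _ _ _ _ r' r (esym E)).
split=> //; subst a'.
have le2 y y' : in_range a y -> in_range a y' ->
    progression a y = progression a y' -> (y' <= y)%N.
  move=> ry ry' Ey; have [k kx] := mem_progression ry l_ge2.
  rewrite Ey => /progressionP[[|i] _ ki].
    by have /and3P[_ ? _] := ry; lia.
  by rewrite mulSn in ki; lia.
by apply/eqP; rewrite eqn_leq (le2 _ _ r r' E) (le2 _ _ r' r (esym E)).
Qed.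

Lemma card_AP S : S \in APs n l -> #|S| = l.
Proof. by move=> /APsP[a [b [r ->]]]; exact: card_progression. Qed.

(** A progression through x is determined by the index of x and the step, which is at most n / (l -
    1); and l <= 2 (l - 1). *)
Lemma AP_degree (x : 'I_n) : (#|[set S in APs n l | x \in S]%SET| <= 2 * n)%N.
Proof.
pose f (z : 'I_l * 'I_(n %/ l.-1)) := progression (x.+1 - z.1 * z.2.+1) z.2.+1.
apply: (@leq_trans #|[set f z | z in finset.setT]%SET|).
  apply/subset_leq_card/fintype.subsetP => S; rewrite inE => /andP[/APsP[a [b [r ->]]]].
  move=> /progressionP[i il xi]; have /and3P[a0 b0 ab] := r.
  have bn : (b.-1 < n %/ l.-1)%N.
    rewrite prednK // leq_divRL; first by rewrite mulnC (leq_trans _ ab) ?leq_addl.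
    by case: (l) l_ge2 => [|[]].
  apply/imsetP; exists (Ordinal il, Ordinal bn) => //.
  by rewrite /f /= prednK // xi addnK.
apply: leq_trans (leq_imset_card _ _) _; rewrite cardsT card_prod !card_ord.
have := leq_trunc_div n l.-1; nia.
Qed.

(** The indices i and j of x and y determine the step |x - y| / |i - j|, and then the first term. *)
Lemma AP_codegree (x y : 'I_n) : x != y ->
  (#|[set S in APs n l | (x \in S) && (y \in S)]%SET| <= l ^ 2)%N.
Proof.
move=> xy; pose dist i j := (i - j + (j - i))%N.
pose f (z : 'I_l * 'I_l) := let b := (dist x y %/ dist z.1 z.2)%N in
  progression (x.+1 - z.1 * b) b.
apply: (@leq_trans #|[set f z | z in finset.setT]%SET|).
  apply/subset_leq_card/fintype.subsetP => S; rewrite inE => /andP[/APsP[a [b [r ->]]]].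
  move=> /andP[/progressionP[i il xi] /progressionP[j jl yj]].
  have xy' : x.+1 <> y.+1 by move=> -[/val_inj/eqP]; exact/negP.
  apply/imsetP; exists (Ordinal il, Ordinal jl) => //; rewrite /f /=.
  have ij : i <> j by move=> ij; apply: xy'; rewrite xi yj ij.
  have -> : dist x y = (b * dist i j)%N.
    by rewrite -[LHS](_ : dist x.+1 y.+1 = _) // xi yj /dist; nia.
  by rewrite mulnK ?xi ?addnK // /dist; lia.
by apply: leq_trans (leq_imset_card _ _) _; rewrite cardsT card_prod !card_ord.
Qed.

Lemma card_le_inj (T : finType) (A : {set T}) (g : T -> nat) m :
  {in A, forall k, g k < m}%N -> {in A &, injective g} -> (#|A| <= m)%N.
Proof.
move=> gm g_inj; rewrite cardE -(size_map g) -[m](size_iota 0).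
apply: uniq_leq_size.
  by rewrite map_inj_in_uniq ?enum_uniq // => x y; rewrite !mem_enum; exact: g_inj.
by move=> x /mapP[k]; rewrite mem_enum mem_iota add0n => /gm gk ->.
Qed.

(* More than half of the first progression lies in the second, so two consecutive
   elements do, and b is a multiple of b'. *)
Lemma large_overlap_step a b a' b' : in_range a b -> in_range a' b' ->
  (uphalf l < #|progression a b :&: progression a' b'|)%N -> (b' <= b)%N.
Proof.
move=> /and3P[a0 b0 ab] _; apply: contraTT; rewrite -ltnNge -leqNgt => bb'.
(* Pigeonhole over the [uphalf l] blocks of indices {2t, 2t+1}. Two common points in one block would
   be at distance b, which is impossible for distinct terms of a progression of step b' > b. *)
pose g (k : 'I_n) := ((k.+1 - a) %/ b)./2.
apply: (@card_le_inj _ _ g) => [k|k k'].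
  rewrite finset.in_setI => /andP[/progressionP[i il ki] _].
  by rewrite /g ki addKn mulnK //; lia.
rewrite !finset.in_setI => /andP[/progressionP[i il ki] /progressionP[u ul ku]].
move=> /andP[/progressionP[j jl kj] /progressionP[v vl kv]].
rewrite /g ki kj !addKn !mulnK // => ij; apply: val_inj; apply: succn_inj.
have [ij1|ij1] := eqVneq i j; first by rewrite ki kj ij1.
have [ij2|ij2] : i = j.+1 \/ j = i.+1 by lia.
  have E : (a' + u * b' = a' + v * b' + b)%N by rewrite -ku -kv ki kj ij2; lia.
  have uv : (v < u)%N by rewrite ltnNge; apply/negP => uv; nia.
  by have := leq_mul2r b' v.+1 u; rewrite uv orbT mulSn; lia.
have E : (a' + v * b' = a' + u * b' + b)%N by rewrite -ku -kv ki kj ij2; lia.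
have uv : (u < v)%N by rewrite ltnNge; apply/negP => uv; nia.
by have := leq_mul2r b' u.+1 v; rewrite uv orbT mulSn; lia.
Qed.

(** A common point with index u in the shifted progression has index u + j in the original one, so u
    < l - j. *)
Lemma shift_overlap a b j : in_range a b ->
  (#|progression a b :&: progression (a + j * b) b| <= l - j)%N.
Proof.
move=> /and3P[a0 b0 ab]; apply: (@card_le_inj _ _ (fun k : 'I_n => (k.+1 - a) %/ b - j)%N).
  move=> k; rewrite finset.in_setI => /andP[/progressionP[i il ki] /progressionP[u ul ku]].
  have := ki; rewrite ku -addnA => /addnI; rewrite -mulnDl => /eqP.
  rewrite eqn_mul2r (gtn_eqF b0) => /eqP ji.
  by rewrite addKn mulnK //; lia.
move=> k k'; rewrite !finset.in_setI.
move=> /andP[/progressionP[i il ki] /progressionP[u ul ku]].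
move=> /andP[/progressionP[i' il' ki'] /progressionP[u' ul' ku']].
rewrite ku ku' -!addnA !addKn -!mulnDl !mulnK // => E.
by apply: val_inj; apply: succn_inj; rewrite ku ku'; congr (_ + _ * _)%N; lia.
Qed.

(** Comparing the steps in both directions makes them equal; the shift is the difference of the two
    indices of a common point. The subtraction is truncated, but in the second case a is the first
    term of B plus j b, so nothing is lost. *)
Lemma large_overlapP a b B : in_range a b -> B \in APs n l -> B != progression a b ->
    (uphalf l < #|progression a b :&: B|)%N ->
  exists2 j, (0 < j < l)%N & (#|progression a b :&: B| <= l - j)%N /\
    (B = progression (a + j * b) b \/ B = progression (a - j * b) b).
Proof.
move=> r /APsP[a' [b' [r' ->]]] neq large.
have bb' : b' = b.
  apply/eqP; rewrite eqn_leq (large_overlap_step r r' large) /=.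
  by apply: large_overlap_step r' r _; rewrite finset.setIC.
subst b'; have [a0 b0 ab] := and3P r; have [a'0 _ ab'] := and3P r'.
have /card_gt0P[k] : (0 < #|progression a b :&: progression a' b|)%N by lia.
rewrite finset.in_setI => /andP[/progressionP[i il ki] /progressionP[u ul ku]].
have E : (a + i * b = a' + u * b)%N by rewrite -ki.
have [iu|ui|iu] := ltngtP i u.
- have aE : a = (a' + (u - i) * b)%N by rewrite mulnBl; nia.
  exists (u - i)%N; first by lia.
  split; first by rewrite finset.setIC aE; exact: shift_overlap.
  by right; rewrite [in RHS]aE addnK.
- have aE : a' = (a + (i - u) * b)%N by rewrite mulnBl; nia.
  exists (i - u)%N; first by lia.
  by split; [rewrite aE; exact: shift_overlap | left; rewrite aE].
- by case/negP: neq; apply/eqP; congr progression; rewrite iu in E; lia.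
Qed.

End ArithmeticProgressions.

(** * Overlaps in at least two points, and the number of progressions *)

Lemma geometric_tail (R : realFieldType) (q : R) m : 0 <= q <= 2^-1 ->
  \sum_(j < m | (0 < j)%N) q ^+ j <= 2 * q.
Proof.
move=> /andP[q0 q2]; case: m => [|m]; first by rewrite big_ord0 mulr_ge0.
rewrite big_mkcond big_ord_recl /= add0r.
under eq_bigr do rewrite /bump /= add1n exprS.
rewrite -mulr_sumr [leRHS]mulrC ler_wpM2l //.
have := subrX1 q m; set s := \sum_(i < m) _ => E.
have : 0 <= q ^+ m by rewrite exprn_ge0.
have : 0 <= s by apply: sumr_ge0 => i _; rewrite exprn_ge0.
by nra.
Qed.

(** The quotient h^4 / 2^h is largest at h = 6, where it equals 20.25. *)
Lemma pow4_le h : (h ^ 4 <= 21 * 2 ^ h)%N.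
Proof.
have [|h6] := leqP h 6; first by case: h => [|[|[|[|[|[|[|]]]]]]].
elim: h h6 => // h IH; rewrite ltnS leq_eqVlt => /predU1P[<- //|h6].
apply: (@leq_trans (2 * h ^ 4)); last by rewrite [(2 ^ _)%N]expnS mulnCA leq_mul2l IH.
have [k ->] : exists k, h = (7 + k)%N by exists (h - 7)%N; lia.
by rewrite !(expnS _ 3, expnS _ 2, expnS _ 1, expn1); nia.
Qed.

(** With h = l./2 one has l <= 3 h, so l^4 is at most a constant times 2^h, and (2q)^h <= 2q because
    2q <= 1. *)
Lemma pow4_half_bound (R : realFieldType) : exists2 C : R, 0 <= C &
  forall l (q : R), (1 < l)%N -> 0 <= q <= 2^-1 -> (l ^ 4)%:R * q ^+ l./2 <= C * q.
Proof.
have [m mP] : exists m, forall h, (0 < h -> (3 * h) ^ 4 <= m * 2 ^ h)%N.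
  by exists (81 * 21)%N => h _; rewrite expnMn -mulnA leq_mul2l pow4_le.
exists (2 * m%:R); first by rewrite mulr_ge0.
move=> l q l1 /andP[q0 q2].
have [h hE] : exists h, l./2 = h.+1 by exists l./2.-1; lia.
apply: (@le_trans _ _ ((m * 2 ^ h.+1)%:R * q ^+ h.+1)).
  rewrite hE ler_wpM2r ?exprn_ge0 // ler_nat (leq_trans _ (mP h.+1 _)) //.
  by rewrite leq_exp2r //; lia.
have -> : (m * 2 ^ h.+1)%:R * q ^+ h.+1 = 2 * m%:R * q * (2 * q) ^+ h.
  by rewrite !natrM natrX exprMn !exprS; ring.
have q21 : 2 * q <= 1 by lra.
by rewrite ler_piMr ?mulr_ge0 // exprn_ile1 ?mulr_ge0.
Qed.

Lemma AP_overlap_sum (R : realFieldType) : exists2 C : R, 0 <= C &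
  forall n l (q : R) (S : {set 'I_n}), (1 < l)%N -> 0 <= q <= 2^-1 -> S \in APs n l ->
  \sum_(B in APs n l | (B != S) && (1 < #|S :&: B|)%N) q ^+ (l - #|S :&: B|)
    <= C * q.
Proof.
have [C0 C00 C0P] := pow4_half_bound R.
(* [C0] pays for the at most l^4 progressions with small overlap, each weighing at most q^(l/2). The
   4 pays for two shifts per distance j and a geometric sum at most 2q. *)
exists (C0 + 4) => [|n l q S l_ge2 q12 SF]; first by rewrite addr_ge0.
have /andP[q0 q2] := q12; have q1 : q <= 1 by lra.
have Sl := card_AP l_ge2 SF; have /(APsP l_ge2)[a [b [r SE]]] := SF.
rewrite (bigID (fun B => (#|S :&: B| <= uphalf l)%N)) /=.
rewrite [leRHS]mulrDl; apply: lerD.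
  apply: le_trans (C0P _ _ l_ge2 q12).
  apply: (@le_trans _ _ (\sum_(B in APs n l | (1 < #|S :&: B|)%N) q ^+ l./2)).
    rewrite big_mkcond [leRHS]big_mkcond.
    apply: ler_sum => B _; case: ifP => [/andP[/and3P[-> _ ->] le]|_].
      by apply: ler_wiXn2l => //; have := uphalf_half l; have := odd_double_half l; lia.
    by case: ifP; rewrite ?exprn_ge0.
  rewrite sumr_const -[leLHS]mulr_natl ler_wpM2r ?exprn_ge0 // ler_nat.
  have := card_overlap_le (AP_codegree l_ge2) S; rewrite Sl -expnD.
  by apply: leq_trans; rewrite cardsE.
(* Shifts leaving the range, and those altered by truncated subtraction, may be listed too: they
   only increase an upper bound. *)
pose D j B := ((B == progression n l (a + j * b) b) + (B == progression n l (a - j * b) b))%N.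
apply: (@le_trans _ _ (\sum_(B in APs n l) \sum_(j < l | (0 < j)%N) (D j B)%:R * q ^+ j)).
  rewrite big_mkcond [leRHS]big_mkcond /=; apply: ler_sum => B _.
  have pos (j : 'I_l) : 0 <= (D j B)%:R * q ^+ j by rewrite mulr_ge0 ?exprn_ge0.
  case: ifP => [/andP[/and3P[BF BS _]]|_]; last by case: ifP => // _; exact: sumr_ge0.
  rewrite BF -ltnNge SE => large; rewrite SE in BS.
  have [j /andP[j0 jl] [le BE]] := large_overlapP l_ge2 r BF BS large.
  rewrite (bigD1 (Ordinal jl)) //= ler_wpDr //.
    by apply: sumr_ge0 => i _.
  have D1 : 1 <= (D j B)%:R :> R.
    by rewrite ler1n /D; case: BE => ->; rewrite eqxx ?addn1.
  have ql : q ^+ (l - #|progression n l a b :&: B|) <= q ^+ j.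
    by apply: ler_wiXn2l => //; move: (#|_|) le => k; lia.
  by apply: le_trans ql _; rewrite ler_peMl ?exprn_ge0.
rewrite exchange_big /=.
apply: (@le_trans _ _ (\sum_(j < l | (0 < j)%N) 2 * q ^+ j)); last first.
  by rewrite -mulr_sumr; have := geometric_tail l q12; lra.
apply: ler_sum => j _; rewrite -mulr_suml ler_wpM2r ?exprn_ge0 //.
rewrite -natr_sum ler_nat big_split /=.
have one C : (\sum_(B in APs n l) (B == C) <= 1)%N.
  rewrite -big_mkcondr sum1dep_card (leq_trans (subset_leq_card _) (eq_leq (cards1 C))) //.
  by apply/fintype.subsetP => B; rewrite !inE => /andP[].
by rewrite (leq_add (one _) (one _)).
Qed.

(** For step b + 1 the first term ranges over 1, ..., n - (l - 1)(b + 1). Truncated subtraction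
    makes the contribution of too large steps zero. *)
Lemma card_APs n l : (1 < l)%N ->
  #|APs n l| = (\sum_(b < n) (n - l.-1 * b.+1))%N.
Proof.
move=> l1.
pose D := [set z : 'I_n.+1 * 'I_n.+1 | in_range n l z.2 z.1]%SET.
have -> : #|APs n l| = #|D|.
  pose f (z : 'I_n.+1 * 'I_n.+1) := progression n l z.2 z.1.
  rewrite -(card_in_imset (f := f) (D := D)).
    apply: eq_card => S; apply/(APsP l1)/imsetP => [[a [b [r ->]]]|[[b a]]].
      have /and3P[a0 b0 ab] := r.
      have an : (a < n.+1)%N by rewrite ltnS (leq_trans (leq_addr _ _) ab).
      have bn : (b < n.+1)%N.
        rewrite ltnS (leq_trans _ ab) // (leq_trans _ (leq_addl _ _)) // leq_pmull //.
        by case: (l) l1 => [|[]].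
      by exists (Ordinal bn, Ordinal an); rewrite // inE.
    by rewrite inE /= => r ->; exists a, b.
  move=> [b a] [b' a']; rewrite !inE /= => r r' /(progression_inj l1 r r')[aa bb].
  by congr pair; apply: val_inj.
rewrite -sum1dep_card -(pair_big_dep xpredT (fun b a : 'I_n.+1 => in_range n l a b)
  (fun _ _ => 1%N)) /= big_ord_recl big1 ?add0n; last first.
  by move=> a; rewrite /in_range /= andbF.
apply: eq_bigr => b _; rewrite big_mkcond /=.
have count m : (m <= n.+1)%N ->
    (\sum_(a < m) (if in_range n l a (bump 0 b) then 1 else 0) =
     minn m.-1 (n - l.-1 * b.+1))%N.
  elim: m => [|m IH] mn; first by rewrite big_ord0 min0n.
  rewrite big_ord_recr /= IH ?(ltnW mn) // /in_range /bump add1n /=.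
  move: (l.-1 * b.+1)%N => t; case: m {IH} mn => [|m] mn /=; first by rewrite !min0n.
  have [|] := leqP (m.+1 + t) n => h; rewrite ?addn0 ?addn1.
    by rewrite !(minn_idPl _) //; lia.
  by rewrite !(minn_idPr _) //; lia.
by rewrite count //=; lia.
Qed.

(** With m = l - 1, the squares of [y b] = n - m b telescope: their decrease per step is compared
    with 2 m [y (b + 1)] for the upper bound and 2 m [y b] for the lower one. Truncation at zero
    preserves both comparisons. *)
Lemma card_APs_bounds n l : (1 < l)%N ->
  ((n - l.-1) ^ 2 <= 2 * l.-1 * #|APs n l| <= n ^ 2)%N.
Proof.
move=> l1; rewrite card_APs //; have : (0 < l.-1)%N by lia.
move: l.-1 => m m0; pose y b := (n - m * b)%N.
have up k : (2 * m * \sum_(b < k) y b.+1 + y k ^ 2 <= n ^ 2)%N.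
  elim: k => [|k IH]; first by rewrite big_ord0 /y !muln0 subn0.
  apply: leq_trans IH; rewrite big_ord_recr /= mulnDr -addnA leq_add2l.
  by rewrite /y mulnS -!mulnn; nia.
have low k : (y 1 ^ 2 <= 2 * m * \sum_(b < k) y b.+1 + y k.+1 ^ 2)%N.
  elim: k => [|k IH]; first by rewrite big_ord0 muln0.
  apply: leq_trans IH _; rewrite big_ord_recr /= mulnDr -addnA leq_add2l.
  by rewrite /y [(m * k.+2)%N]mulnS -!mulnn; nia.
apply/andP; split; last by apply: leq_trans (leq_addr _ _) (up n).
have := low n; rewrite {1}/y muln1 (_ : y n.+1 = 0)%N ?addn0 //.
by rewrite /y; nia.
Qed.

(** * Test functions for the normal law *)

Section RealDerivatives.
Context (R : realType).
Implicit Types f g df dg : R -> R.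

Definition deriv_is f df := forall x : R, is_derive x 1 f (df x).

Lemma deriv_is_ext f df dg : deriv_is f df -> df =1 dg -> deriv_is f dg.
Proof. by move=> fdf e x; rewrite -e. Qed.

Lemma deriv_is_cst c : deriv_is (fun=> c) (fun=> 0).
Proof. by move=> x; exact: is_derive_cst. Qed.

Lemma deriv_is_id : deriv_is (fun x => x) (fun=> 1).
Proof. by move=> x; exact: is_derive_id. Qed.

Lemma deriv_isD f df g dg : deriv_is f df -> deriv_is g dg ->
  deriv_is (fun x => f x + g x) (fun x => df x + dg x).
Proof. by move=> fd gd x; exact: is_deriveD. Qed.

Lemma deriv_isB f df g dg : deriv_is f df -> deriv_is g dg ->
  deriv_is (fun x => f x - g x) (fun x => df x - dg x).
Proof. by move=> fd gd x; exact: is_deriveB. Qed.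

Lemma deriv_isM f df g dg : deriv_is f df -> deriv_is g dg ->
  deriv_is (fun x => f x * g x) (fun x => df x * g x + f x * dg x).
Proof.
move=> fd gd x; apply: is_derive_eq (is_deriveM (fd x) (gd x)) _.
by rewrite /GRing.scale /=; ring.
Qed.

Lemma deriv_is_comp f df g dg : deriv_is f df -> deriv_is g dg ->
  deriv_is (fun x => f (g x)) (fun x => df (g x) * dg x).
Proof. by move=> fd gd x; exact: is_derive1_comp. Qed.

Lemma deriv_is_itv_MVT f df (a b : R) : (forall x : R, x \in `[a, b] -> is_derive x 1 f (df x)) ->
  a < b -> exists2 c, a < c < b & f b - f a = df c * (b - a).
Proof.
move=> fd ab.
have fd_oo x : x \in `]a, b[ -> is_derive x 1 f (df x).
  by move=> xab; apply: fd; apply: subset_itv_oo_cc xab.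
have fc : {within `[a, b], continuous f}.
  by apply: derivable_within_continuous => x xab; have [] := fd x xab.
by have [c] := MVT ab fd_oo fc; rewrite in_itv; exists c.
Qed.

Lemma deriv_is_MVT f df (a b : R) : deriv_is f df ->
  exists2 c, (`|c - a| <= `|b - a|) & f b - f a = df c * (b - a).
Proof.
move=> fd; have [ab|ba|->] := ltgtP a b.
- have [c /andP[ac cb] E] := deriv_is_itv_MVT (fun x _ => fd x) ab.
  by exists c => //; rewrite !gtr0_norm; lra.
- have [c /andP[ac cb] E] := deriv_is_itv_MVT (fun x _ => fd x) ba.
  by exists c; [rewrite !ltr0_norm; lra | lra].
- by exists b; rewrite ?subrr ?mulr0.
Qed.

Lemma taylor2 f f' f'' K : deriv_is f f' -> deriv_is f' f'' ->
    (forall x, `|f'' x| <= K) ->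
  (forall x y, `|f y - f x - f' x * (y - x)| <= K * (y - x) ^+ 2) /\
  (forall x y, `|f' y - f' x| <= K * `|y - x|).
Proof.
move=> fd fd' K''.
have lip x y : `|f' y - f' x| <= K * `|y - x|.
  by have [c _ ->] := deriv_is_MVT x y fd'; rewrite normrM ler_wpM2r.
split=> // x y; have [c cx ->] := deriv_is_MVT x y fd.
rewrite -mulrBl normrM; apply: le_trans (ler_wpM2r (normr_ge0 _) (lip _ _)) _.
have K0 : 0 <= K by apply: le_trans (K'' 0).
by rewrite -[in leRHS]real_normK ?num_real // -mulrA ler_wpM2l // expr2 ler_wpM2r.
Qed.

Definition pospart (x : R) : R := Num.max x 0.

(** Serves to differentiate the squared positive part at its kink, where the product rule does not
    apply. *)
Lemma is_derive_quadratic f d x C :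
  (forall h, `|f (x + h) - f x - d * h| <= C * h ^+ 2) -> is_derive x 1 f d.
Proof.
move=> fC.
have C0 : 0 <= C.
  by have := fC 1; rewrite expr1n !mulr1 => C1; rewrite (le_trans _ C1).
have lim : h^-1 *: ((f \o shift x) (h *: 1) - f x) @[h --> 0^'] --> d.
  apply/cvgrPdist_le => e e0; near=> h.
  have h0 : h != 0 by near: h; exact: nbhs_dnbhs_neq.
  have -> : d - h^-1 *: ((f \o shift x) (h *: 1) - f x) =
      - (h^-1 * (f (x + h) - f x - d * h)).
    by rewrite /GRing.scale /= mulr1 [h + x]addrC; field.
  rewrite normrN normrM normfV ler_pdivrMl ?normr_gt0 //.
  apply: le_trans (fC h) _.
  rewrite -real_normK ?num_real // expr2 mulrCA ler_wpM2l //.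
  have : `|h| <= e / (C + 1).
    near: h; apply: dnbhs0_le; rewrite divr_gt0 //; lra.
  rewrite ler_pdivlMr; last by lra.
  by have := normr_ge0 h; nra.
by split; [apply/cvg_ex; exists d | exact: cvg_lim lim].
Unshelve. all: by end_near.
Qed.

Lemma deriv_is_pospart2 : deriv_is (fun x => pospart x ^+ 2) (fun x => 2 * pospart x).
Proof.
move=> x; apply: (@is_derive_quadratic _ _ _ 1) => h; rewrite mul1r /pospart /Num.max.
by case: ltP => ?; case: ltP => ?; rewrite ler_norml; apply/andP; split; nra.
Qed.

Lemma pospart3E x : pospart x ^+ 3 = x * pospart x ^+ 2.
Proof. by rewrite /pospart /Num.max; case: ltP => _; rewrite ?expr0n ?mulr0 // exprS. Qed.

Lemma deriv_is_pospart3 : deriv_is (fun x => pospart x ^+ 3) (fun x => 3 * pospart x ^+ 2).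
Proof.
have -> : (fun x => pospart x ^+ 3) = (fun x => x * pospart x ^+ 2).
  by apply/funext => x; exact: pospart3E.
apply: deriv_is_ext (deriv_isM deriv_is_id deriv_is_pospart2) _ => x.
by rewrite /pospart /Num.max; case: ltP => _; rewrite /=; ring.
Qed.

End RealDerivatives.

Section SmoothStep.
Context (R : realType).

(* The integrated quadratic B-spline with knots 0, 1, 2, 3. *)
Definition bstep (u : R) : R := 6^-1 * (pospart u ^+ 3 - 3 * pospart (u - 1) ^+ 3 +
  3 * pospart (u - 2) ^+ 3 - pospart (u - 3) ^+ 3).
Definition bstep' (u : R) : R := 2^-1 * (pospart u ^+ 2 - 3 * pospart (u - 1) ^+ 2 +
  3 * pospart (u - 2) ^+ 2 - pospart (u - 3) ^+ 2).
Definition bstep'' (u : R) : R :=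
  pospart u - 3 * pospart (u - 1) + 3 * pospart (u - 2) - pospart (u - 3).

Let deriv_is_shift (f df : R -> R) (c : R) : deriv_is f df ->
  deriv_is (fun u => f (u - c)) (fun u => df (u - c)).
Proof.
move=> fd; have := deriv_is_comp fd (deriv_isB (@deriv_is_id R) (deriv_is_cst c)).
by move/deriv_is_ext; apply => u; rewrite subr0 mulr1.
Qed.

Let deriv_isZ (f df : R -> R) (c : R) : deriv_is f df ->
  deriv_is (fun u => c * f u) (fun u => c * df u).
Proof.
move=> fd; have := deriv_isM (deriv_is_cst c) fd.
by move/deriv_is_ext; apply => u; rewrite mul0r add0r.
Qed.

Let spline4 (f df : R -> R) (a : R) : deriv_is f df -> deriv_is
  (fun u => a * (f u - 3 * f (u - 1) + 3 * f (u - 2) - f (u - 3)))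
  (fun u => a * (df u - 3 * df (u - 1) + 3 * df (u - 2) - df (u - 3))).
Proof.
move=> fd; have s c := deriv_is_shift c fd.
exact: deriv_isZ (deriv_isB (deriv_isD (deriv_isB fd (deriv_isZ 3 (s 1)))
  (deriv_isZ 3 (s 2))) (s 3)).
Qed.

Lemma deriv_is_bstep : deriv_is bstep bstep'.
Proof.
apply: deriv_is_ext (spline4 6^-1 (@deriv_is_pospart3 R)) _ => u.
by rewrite /bstep'; field.
Qed.

Lemma deriv_is_bstep' : deriv_is bstep' bstep''.
Proof.
apply: deriv_is_ext (spline4 2^-1 (@deriv_is_pospart2 R)) _ => u.
by rewrite /bstep''; field.
Qed.

Let pos0 (u : R) : u <= 0 -> pospart u = 0.
Proof. by rewrite /pospart /Num.max; case: ltP => //; lra. Qed.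

Let posE (u : R) : 0 <= u -> pospart u = u.
Proof. by rewrite /pospart /Num.max; case: ltP => //; lra. Qed.

Lemma bstep_le0 u : u <= 0 -> [/\ bstep u = 0, bstep' u = 0 & bstep'' u = 0].
Proof.
move=> u0; rewrite /bstep /bstep' /bstep'' !pos0; try lra.
by rewrite !expr0n /=; split; ring.
Qed.

Lemma bstep_ge3 u : 3 <= u -> [/\ bstep u = 1, bstep' u = 0 & bstep'' u = 0].
Proof.
move=> u3; rewrite /bstep /bstep' /bstep'' !posE; try lra.
by split; field.
Qed.

Lemma bstep_bounds u : [/\ 0 <= bstep u <= 1, 0 <= bstep' u <= 1 & `|bstep'' u| <= 1].
Proof.
have [u0|u0] := leP u 0.
  by have [-> -> ->] := bstep_le0 u0; rewrite normr0 !lexx !ler01.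
have [u3|u3] := leP 3 u.
  by have [-> -> ->] := bstep_ge3 u3; rewrite normr0 !lexx !ler01.
rewrite /bstep /bstep' /bstep'' (posE (ltW u0)) [pospart (u - 3)]pos0; last lra.
have [u1|u1] := leP u 1.
  rewrite [pospart (u - 1)]pos0 ?[pospart (u - 2)]pos0; try lra.
  by rewrite ler_norml; split; apply/andP; split; nra.
rewrite [pospart (u - 1)]posE; last lra.
have [u2|u2] := leP u 2.
  rewrite [pospart (u - 2)]pos0; last lra.
  have {u0 u1 u2 u3} : 0 <= u - 1 <= 1 by lra.
  have [v -> ] : exists v, u = v + 1 by exists (u - 1); ring.
  rewrite addrK => /andP[v0 v1].
  (* These nonnegative products certify the polynomial bounds on the middle piece, so that only
     linear combinations remain. *)
  have v2 : 0 <= v * (1 - v) by rewrite mulr_ge0 ?subr_ge0.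
  have v3 : 0 <= v * (1 - v) ^+ 2 by rewrite mulr_ge0 ?sqr_ge0.
  have v5 : 0 <= (2 * v - 1) ^+ 2 by rewrite sqr_ge0.
  have v4 : 0 <= v ^+ 2 * (1 - v) by rewrite mulr_ge0 ?subr_ge0 ?sqr_ge0.
  by rewrite ler_norml !expr0n /=; split; apply/andP; split; lra.
rewrite [pospart (u - 2)]posE; last lra.
have E3 : u ^+ 3 - 3 * (u - 1) ^+ 3 + 3 * (u - 2) ^+ 3 - 0 ^+ 3 = 6 - (3 - u) ^+ 3.
  by rewrite expr0n /=; ring.
have E2 : u ^+ 2 - 3 * (u - 1) ^+ 2 + 3 * (u - 2) ^+ 2 - 0 ^+ 2 = (3 - u) ^+ 2.
  by rewrite expr0n /=; ring.
have E1 : u - 3 * (u - 1) + 3 * (u - 2) - 0 = - (3 - u) by ring.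
rewrite E3 E2 E1; have : 0 <= 3 - u <= 1 by lra.
move: (3 - u) => v /andP[v0 v1].
have [v20 v30] : 0 <= v ^+ 2 /\ 0 <= v ^+ 3 by rewrite !exprn_ge0.
have [v21 v31] : v ^+ 2 <= 1 /\ v ^+ 3 <= 1 by rewrite !exprn_ile1.
by rewrite normrN ger0_norm //; split=> //; apply/andP; split; lra.
Qed.

End SmoothStep.

(** * Tail bounds of Mills type for the Gaussian density *)

Section GaussianTail.
Context (R : realType) (k : R).
Hypothesis k_gt0 : 0 < k.

Definition gauss (x : R) : R := k * expR (- (x ^+ 2 / 2)).
Definition inv_gauss (x : R) : R := k^-1 * expR (x ^+ 2 / 2).

Lemma gaussE x : gauss x * inv_gauss x = 1.
Proof.
rewrite /gauss /inv_gauss mulrACA mulfV ?gt_eqF // mul1r mulrC.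
exact: expRxMexpNx_1.
Qed.

Lemma inv_gaussN x : inv_gauss (- x) = inv_gauss x.
Proof. by rewrite /inv_gauss sqrrN. Qed.

Lemma gaussN x : gauss (- x) = gauss x.
Proof. by rewrite /gauss sqrrN. Qed.

Lemma gauss_gt0 x : 0 < gauss x.
Proof. by rewrite mulr_gt0 ?expR_gt0. Qed.

Lemma inv_gauss_gt0 x : 0 < inv_gauss x.
Proof. by rewrite mulr_gt0 ?expR_gt0 ?invr_gt0. Qed.

Lemma gauss_le x : gauss x <= k.
Proof.
rewrite /gauss ger_pMr // -[leRHS]expR0 ler_expR oppr_le0.
by rewrite divr_ge0 ?sqr_ge0.
Qed.

Let deriv_is_sqr2 : deriv_is (fun x : R => x ^+ 2 / 2) (fun x => x).
Proof.
have := deriv_isM (deriv_isM (@deriv_is_id R) (@deriv_is_id R)) (deriv_is_cst 2^-1).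
by move/deriv_is_ext; apply => x; rewrite mulr0 addr0; field.
Qed.

Lemma deriv_is_inv_gauss : deriv_is inv_gauss (fun x => x * inv_gauss x).
Proof.
have := deriv_isM (deriv_is_cst k^-1) (deriv_is_comp (@is_derive_expR R) deriv_is_sqr2).
by move/deriv_is_ext; apply => x; rewrite mul0r add0r /inv_gauss; ring.
Qed.

Lemma deriv_is_gauss : deriv_is gauss (fun x => - x * gauss x).
Proof.
have := deriv_isM (deriv_is_cst k) (deriv_is_comp (@is_derive_expR R)
  (deriv_isB (deriv_is_cst 0) deriv_is_sqr2)).
have -> : (fun x => k * expR (0 - x ^+ 2 / 2)) = gauss.
  by apply/funext => x; rewrite sub0r.
by move/deriv_is_ext; apply => x; rewrite mul0r add0r !sub0r /gauss; ring.
Qed.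

Context (F : R -> R).
Hypothesis F_deriv : deriv_is F gauss.
Hypothesis F_ge0 : forall x, 0 <= F x.
Hypothesis F_Ny0 : forall e x, 0 < e -> exists2 w, w < x & F w < e.

(** F + gauss / x decreases on the negative axis and is at most F there. A positive value at w would
    exceed its value at a point v < w where F is small. *)
Lemma gauss_tail_le w : w < 0 -> F w <= - gauss w / w.
Proof.
move=> w0; rewrite leNgt; apply/negP => Fw.
pose H x := F x + gauss x / x.
have dH (x : R) : x < 0 -> is_derive x 1 H (- gauss x / x ^+ 2).
  move=> x0; have x_neq0 : x != 0 by rewrite lt_eqF.
  have := is_deriveD (F_deriv x) (is_deriveM (deriv_is_gauss x)
    (is_deriveV x_neq0 (@deriv_is_id R x))).
  move=> /is_derive_eq; apply; rewrite /GRing.scale /=.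
  by field.
have Hw : 0 < H w by rewrite /H; move: Fw; rewrite mulNr; lra.
have [v vw Fv] := F_Ny0 w Hw.
have v0 := lt_trans vw w0.
have [|c /andP[vc cw]] := @deriv_is_itv_MVT R H (fun x => - gauss x / x ^+ 2) v w _ vw.
  by move=> x; rewrite in_itv /= => /andP[_ xw]; apply: dH; exact: le_lt_trans xw w0.
have c0 := lt_trans cw w0.
have : - gauss c / c ^+ 2 <= 0.
  by rewrite mulNr oppr_le0 divr_ge0 ?sqr_ge0 // ltW // gauss_gt0.
have : gauss v / v <= 0 by rewrite mulr_ge0_le0 ?invr_le0 ?ltW // gauss_gt0.
have : 0 < w - v by lra.
rewrite {2}/H; move: (gauss c / c ^+ 2) (gauss v / v) => a b wv b0.
by rewrite mulNr; nra.
Qed.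

(** F + x gauss / (1 + x^2) is nondecreasing, with derivative 2 gauss / (1 + x^2)^2. A negative
    value would persist to the left, where the second term tends to 0, and contradict F >= 0. *)
Lemma gauss_tail_ge w : - w * gauss w / (1 + w ^+ 2) <= F w.
Proof.
have sq1 (x : R) : 0 < 1 + x ^+ 2 by rewrite ltr_pwDl ?sqr_ge0.
rewrite leNgt; apply/negP => Fw.
pose H x := F x + x * gauss x / (1 + x ^+ 2).
have dH : deriv_is H (fun x => 2 * gauss x / (1 + x ^+ 2) ^+ 2).
  move=> x; have x_neq0 : 1 + x ^+ 2 != 0 by rewrite gt_eqF.
  have d2 := deriv_isD (deriv_is_cst 1) (deriv_isM (@deriv_is_id R) (@deriv_is_id R)).
  have := is_deriveD (F_deriv x) (is_deriveM
    (deriv_isM (@deriv_is_id R) deriv_is_gauss x)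
    (@is_deriveV _ (fun x => 1 + x ^+ 2) x _ 1 x_neq0 (d2 x))).
  move=> /is_derive_eq; apply; rewrite /GRing.scale /=.
  by field.
have Hw : H w < 0 by move: Fw; rewrite /H mulNr mulNr; lra.
(* So far to the left that k / (-v), which bounds the second term of H in absolute value, is below
   -H w. *)
pose v := - (k / - H w + `|w| + 2).
have kH : 0 < k / - H w by rewrite divr_gt0 // oppr_gt0.
have vw : v < w by have := ler_norm (- w); rewrite normrN /v; lra.
have [c /andP[vc cw]] := @deriv_is_itv_MVT R H _ v w (fun x _ => dH x) vw.
have : 0 <= 2 * gauss c / (1 + c ^+ 2) ^+ 2.
  by rewrite divr_ge0 ?sqr_ge0 // mulr_ge0 // ltW // gauss_gt0.
move=> d0 E; have Hv : H v <= H w.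
  by rewrite -subr_ge0 E mulr_ge0 // subr_ge0 ltW.
have [v2 kv] : v <= -2 /\ k / - H w < - v.
  by have := normr_ge0 w; rewrite /v; split; lra.
clearbody v; have : - v * gauss v / (1 + v ^+ 2) <= k / - v.
  rewrite ler_pdivrMr // mulrAC ler_pdivlMr; last by lra.
  have : 0 <= v ^+ 2 * (k - gauss v) by rewrite mulr_ge0 ?sqr_ge0 ?subr_ge0 ?gauss_le.
  by move: k_gt0; lra.
have : k / - v < - H w.
  rewrite ltr_pdivrMr; last by lra.
  by rewrite mulrC -ltr_pdivrMr //; lra.
have {}Hv : F v + v * gauss v / (1 + v ^+ 2) <= H w := Hv.
rewrite !mulNr; have := F_ge0 v.
by move: Hv; lra.
Qed.

(** The middle expression is the second derivative of F / gauss, which is why the left solution of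
    the Stein equation has a bounded second derivative. *)
Lemma mills_curvature w : w <= -1 ->
  0 <= w + (1 + w ^+ 2) * (F w * inv_gauss w) <= 1.
Proof.
move=> w1; have sq1 : 0 < 1 + w ^+ 2 by rewrite ltr_pwDl ?sqr_ge0.
have E0 := inv_gauss_gt0 w; have w0 : w < 0 by lra.
have := ler_wpM2r (ltW E0) (gauss_tail_ge w).
have := ler_wpM2r (ltW E0) (gauss_tail_le w0).
have -> : - gauss w / w * inv_gauss w = - (gauss w * inv_gauss w) / w by ring.
have -> : - w * gauss w / (1 + w ^+ 2) * inv_gauss w =
  - w * (gauss w * inv_gauss w) / (1 + w ^+ 2) by ring.
rewrite gaussE mulr1 ler_pdivrMr // ler_ndivlMr // => up lo.
by apply/andP; split; nra.
Qed.

End GaussianTail.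

(** * Smoothed solutions of the Stein equation *)

Section SteinTestFunction.
Context (R : realType) (k : R) (F : R -> R).
Hypothesis k_gt0 : 0 < k.
Hypothesis F_deriv : deriv_is F (gauss k).
Hypothesis F_01 : forall x, 0 <= F x <= 1.
Hypothesis F_Ny0 : forall e x, 0 < e -> exists2 w, w < x & F w < e.
Hypothesis F_y1 : forall e x, 0 < e -> exists2 w, x < w & 1 - F w < e.

Let E := inv_gauss k.
Let E_gt0 w : 0 < E w. Proof. exact: inv_gauss_gt0. Qed.

Let F_curv w : w <= -1 -> 0 <= w + (1 + w ^+ 2) * (F w * E w) <= 1.
Proof. by apply: mills_curvature => // x; case/andP: (F_01 x). Qed.

Let F_curvN w : 1 <= w -> -1 <= - w + (1 + w ^+ 2) * ((1 - F w) * E w) <= 1.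
Proof.
move=> w1; pose G x := 1 - F (- x).
have Gd : deriv_is G (gauss k).
  have := deriv_isB (deriv_is_cst 1) (deriv_is_comp F_deriv
    (deriv_isB (deriv_is_cst 0) (@deriv_is_id R))).
  have -> : (fun x : R => 1 - F (0 - x)) = G by apply/funext => x; rewrite sub0r.
  by move/deriv_is_ext; apply => x; rewrite !sub0r gaussN mulrN1 opprK.
have G0 x : 0 <= G x by rewrite subr_ge0; case/andP: (F_01 (- x)).
have GNy e x : 0 < e -> exists2 w, w < x & G w < e.
  move=> /(F_y1 (- x))[v xv Fv]; exists (- v); first by rewrite ltrNl.
  by rewrite /G opprK.
have w1' : - w <= -1 by rewrite lerN2.
have := mills_curvature k_gt0 Gd G0 GNy w1'.
by rewrite /G opprK sqrrN inv_gaussN -/E => /andP[]; lra.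
Qed.

Context (c x y : R).
Hypothesis c01 : 0 <= c <= 1.
Hypothesis xy : x < y.
Hypothesis Fy : F y <= c.

Let s := 3 / (y - x).
Let u w := s * (w - x).
Let chi w := bstep (u w).
Let chi' w := s * bstep' (u w).
Let chi'' w := s ^+ 2 * bstep'' (u w).

Let s_gt0 : 0 < s. Proof. by rewrite divr_gt0 // subr_gt0. Qed.

Let deriv_is_u : deriv_is u (fun=> s).
Proof.
have := deriv_isM (deriv_is_cst s) (deriv_isB (@deriv_is_id R) (deriv_is_cst x)).
by move/deriv_is_ext; apply => w; rewrite mul0r add0r subr0 mulr1.
Qed.

Let deriv_is_chi : deriv_is chi chi'.
Proof.
have := deriv_is_comp (@deriv_is_bstep R) deriv_is_u.
by move/deriv_is_ext; apply => w; rewrite mulrC.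
Qed.

Let deriv_is_chi' : deriv_is chi' chi''.
Proof.
have := deriv_isM (deriv_is_cst s) (deriv_is_comp (@deriv_is_bstep' R) deriv_is_u).
by move/deriv_is_ext; apply => w; rewrite mul0r add0r /chi''; ring.
Qed.

(* Gluing the bounded solutions of f' - w f = 1 - c on the left and
   f' - w f = - c on the right only adds the nonnegative term chi' E (c - F). *)
Let f w := E w * ((1 - c) * F w * (1 - chi w) + c * (1 - F w) * chi w).
Let f' w := w * f w + (1 - c - chi w + chi' w * (E w * (c - F w))).
Let f'' w := f w + w * f' w - 2 * chi' w + chi'' w * (E w * (c - F w)) +
  chi' w * (w * (E w * (c - F w))).

Let deriv_is_f : deriv_is f f'.
Proof.
have dF := F_deriv; have dE := deriv_is_inv_gauss k; have dchi := deriv_is_chi.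
have dl := deriv_isM (deriv_isM (deriv_is_cst (1 - c)) dF)
  (deriv_isB (deriv_is_cst 1) dchi).
have dr := deriv_isM (deriv_isM (deriv_is_cst c) (deriv_isB (deriv_is_cst 1) dF)) dchi.
have := deriv_isM dE (deriv_isD dl dr); move/deriv_is_ext; apply => w.
have := gaussE k_gt0 w; rewrite /f' /f /E.
move: (gauss k w) (inv_gauss k w) (F w) (chi w) (chi' w) => g e Fw h h' ge.
transitivity (w * (e * ((1 - c) * Fw * (1 - h) + c * (1 - Fw) * h)) +
  (g * e) * (1 - c - h) + h' * (e * (c - Fw))); first by ring.
by rewrite ge mul1r -addrA.
Qed.

Let deriv_is_f' : deriv_is f' f''.
Proof.
have dF := F_deriv; have dE := deriv_is_inv_gauss k; have dchi := deriv_is_chi.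
have dE' := deriv_isM dE (deriv_isB (deriv_is_cst c) dF).
have := deriv_isD (deriv_isM (@deriv_is_id R) deriv_is_f)
  (deriv_isD (deriv_isB (deriv_is_cst (1 - c)) dchi) (deriv_isM deriv_is_chi' dE')).
move/deriv_is_ext; apply => w; have := gaussE k_gt0 w; rewrite /f'' /E.
move: (f w) (f' w) => a b.
move: (gauss k w) (inv_gauss k w) (F w) (chi' w) (chi'' w) => g e Fw h' h'' ge.
transitivity (a + w * b - h' - (g * e) * h' + h'' * (e * (c - Fw)) +
  h' * (w * (e * (c - Fw)))); first by ring.
by rewrite ge; ring.
Qed.

Let chi_lo w : w <= x -> [/\ chi w = 0, chi' w = 0 & chi'' w = 0].
Proof.
move=> wx; have u0 : u w <= 0 by rewrite /u pmulr_rle0 // subr_le0.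
by rewrite /chi /chi' /chi''; have [-> -> ->] := bstep_le0 u0; rewrite !mulr0.
Qed.

Let chi_hi w : y <= w -> [/\ chi w = 1, chi' w = 0 & chi'' w = 0].
Proof.
move=> wy; have u3 : 3 <= u w.
  by rewrite /u /s mulrAC ler_pdivlMr ?subr_gt0 // ler_wpM2l // lerB.
by rewrite /chi /chi' /chi''; have [-> -> ->] := bstep_ge3 u3; rewrite !mulr0.
Qed.

Let chi_bounds w : [/\ 0 <= chi w <= 1, 0 <= chi' w <= s & `|chi'' w| <= s ^+ 2].
Proof.
have [b0 /andP[b1 b1'] b2] := bstep_bounds (u w).
rewrite /chi /chi' /chi''; split=> //.
  by rewrite mulr_ge0 ?ler_piMr // ltW.
by rewrite normrM ger0_norm ?sqr_ge0 // ler_piMr ?sqr_ge0.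
Qed.

(** Beyond M the step is constant and f'' reduces to (1 - c) or c times a quantity bounded by the
    tail estimates. On [-M, M] each factor is bounded, and [K1] adds the resulting bounds term by
    term. *)
Let f''_bounded : exists K, forall w, `|f'' w| <= K.
Proof.
pose M := 1 + `|x| + `|y|; pose B := k^-1 * expR (M ^+ 2 / 2).
have M0 : 0 <= M by rewrite !addr_ge0.
have B0 : 0 < B by rewrite mulr_gt0 ?expR_gt0 ?invr_gt0.
pose K1 := B + M * (M * B + (2 + s * B)) + 2 * s + s ^+ 2 * B + s * (M * B).
exists (1 + K1) => w.
have K10 : 0 <= K1 by
  rewrite /K1; do ?[exact: sqr_ge0 | exact: ltW | apply: addr_ge0 | apply: mulr_ge0].
have [/andP[F0 F1] /andP[c0 c1]] := (F_01 w, c01).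
have [wlo|wlo] := leP w (- M).
  have [wx w1] : w <= x /\ w <= -1.
    by have := (normr_ge0 x, normr_ge0 y, ler_norm (- x)); rewrite normrN => -[[]];
      rewrite /M in wlo; split; lra.
  rewrite /f'' /f' /f; have [-> -> ->] := chi_lo wx; have := F_curv w1.
  move: (F w) (E w) => a b h.
  have -> : b * ((1 - c) * a * (1 - 0) + c * (1 - a) * 0) +
    w * (w * (b * ((1 - c) * a * (1 - 0) + c * (1 - a) * 0)) +
    (1 - c - 0 + 0 * (b * (c - a)))) - 2 * 0 + 0 * (b * (c - a)) +
    0 * (w * (b * (c - a))) = (1 - c) * (w + (1 + w ^+ 2) * (a * b)) by ring.
  by move: (w + _) h => t /andP[h0 h1]; rewrite ger0_norm ?mulr_ge0 ?subr_ge0 //; nra.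
have [whi|whi] := leP M w.
  have [wy w1] : y <= w /\ 1 <= w.
    by have := (normr_ge0 x, normr_ge0 y, ler_norm y) => -[[]]; rewrite /M in whi; split; lra.
  rewrite /f'' /f' /f; have [-> -> ->] := chi_hi wy; have := F_curvN w1.
  move: (F w) (E w) => a b h.
  have -> : b * ((1 - c) * a * (1 - 1) + c * (1 - a) * 1) +
    w * (w * (b * ((1 - c) * a * (1 - 1) + c * (1 - a) * 1)) +
    (1 - c - 1 + 0 * (b * (c - a)))) - 2 * 0 + 0 * (b * (c - a)) +
    0 * (w * (b * (c - a))) = c * (- w + (1 + w ^+ 2) * ((1 - a) * b)) by ring.
  move: (- w + _) h => t /andP[h0 h1].
  by rewrite ler_norml; apply/andP; split; nra.
have wM : `|w| <= M by rewrite ler_norml !ltW.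
have EB : E w <= B.
  rewrite ler_wpM2l ?invr_ge0 ?(ltW k_gt0) // ler_expR ler_wpM2r //.
  by rewrite -real_normK ?num_real // lerXn2r.
have [/andP[h0 h1] /andP[h'0 h's] h''s] := chi_bounds w.
have cF : `|c - F w| <= 1 by rewrite ler_norml; lra.
have EcF : `|E w * (c - F w)| <= B.
  by rewrite normrM gtr0_norm // -[leRHS]mulr1 ler_pM ?(ltW (E_gt0 w)).
have fB : `|f w| <= B.
  rewrite /f normrM gtr0_norm // -[leRHS]mulr1 ler_pM ?(ltW (E_gt0 w)) //.
  rewrite ger0_norm; last first.
    rewrite -(subr_ge0 c) in c1; have F1' : 0 <= 1 - F w by rewrite subr_ge0.
    have h1' : 0 <= 1 - chi w by rewrite subr_ge0.
    by rewrite addr_ge0 // mulr_ge0 // mulr_ge0.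
  have a1 : (1 - c) * F w <= 1 - c by rewrite ler_piMr ?subr_ge0.
  have a2 : c * (1 - F w) <= c by rewrite ler_piMr ?lerBlDr ?lerDl.
  have a3 : (1 - c) * F w * (1 - chi w) <= (1 - c).
    by rewrite (le_trans _ a1) // ler_piMr ?mulr_ge0 ?subr_ge0 // lerBlDr lerDl.
  have a4 : c * (1 - F w) * chi w <= c by rewrite (le_trans _ a2) // ler_piMr ?mulr_ge0 ?subr_ge0.
  by lra.
have chi'B (t C : R) : `|t| <= C -> `|chi' w * t| <= s * C.
  by move=> tC; rewrite normrM ger0_norm // ler_pM.
have wB (t C : R) : `|t| <= C -> `|w * t| <= M * C.
  by move=> tC; rewrite normrM ler_pM.
have f'B : `|f' w| <= M * B + (2 + s * B).
  rewrite /f'; apply: le_trans (ler_normD _ _) _; apply: lerD; first exact: wB.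
  apply: le_trans (ler_normD _ _) _; apply: lerD; last exact: chi'B.
  by rewrite ler_norml; lra.
apply: le_trans (_ : K1 <= _); last by rewrite lerDr.
rewrite /f'' /K1; apply: le_trans (ler_normD _ _) _.
apply: lerD; last by apply/chi'B/wB.
apply: le_trans (ler_normD _ _) _; apply: lerD; last by rewrite normrM ler_pM.
apply: le_trans (ler_normD _ _) _; apply: lerD; last first.
  have chi2 : 0 <= 2 * chi' w by rewrite mulr_ge0.
  by rewrite normrN (ger0_norm chi2) ler_wpM2l.
apply: le_trans (ler_normD _ _) _; apply: lerD; [exact: fB | exact: wB].
Qed.

Lemma stein_test_function_exists : exists (f f' : R -> R) (K : R),
  [/\ forall v w, `|f w - f v - f' v * (w - v)| <= K * (w - v) ^+ 2,
      forall v w, `|f' w - f' v| <= K * `|w - v| &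
      forall w : R, (w <= x)%R%:R - c <= f' w - w * f w].
Proof.
have [K f''K] := f''_bounded; exists f, f', K.
have [f_taylor f'_lip] := taylor2 deriv_is_f deriv_is_f' f''K.
split=> // w; rewrite /f' [w * f w + _]addrC addrK.
have [/andP[h0 h1] /andP[h'0 _] _] := chi_bounds w.
have [wx|wx] := leP w x.
  by have [-> -> _] := chi_lo wx; rewrite subr0 mul0r addr0.
rewrite sub0r; suff : 0 <= chi' w * (E w * (c - F w)) by lra.
have [wy|wy] := leP y w.
  by have [_ -> _] := chi_hi wy; rewrite mul0r.
(* On the transition interval F w <= F y <= c, which gives the gluing term its sign. *)
rewrite mulr_ge0 // mulr_ge0 ?(ltW (E_gt0 w)) // subr_ge0; apply: le_trans Fy.
have [t /andP[wt ty] E1] := deriv_is_itv_MVT (fun z _ => F_deriv z) wy.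
by rewrite -subr_ge0 E1 mulr_ge0 ?subr_ge0 ?ltW // gauss_gt0.
Qed.

End SteinTestFunction.

Lemma stein_test_function (R : realType) (k : R) (F : R -> R) (c x : R) :
    0 < k -> deriv_is F (gauss k) -> (forall x, 0 <= F x <= 1) ->
    (forall e x : R, 0 < e -> exists2 w, w < x & F w < e) ->
    (forall e x : R, 0 < e -> exists2 w, x < w & 1 - F w < e) ->
    F x < c <= 1 ->
  exists (f f' : R -> R) (K : R),
  [/\ forall v w, `|f w - f v - f' v * (w - v)| <= K * (w - v) ^+ 2,
      forall v w, `|f' w - f' v| <= K * `|w - v| &
      forall w : R, (w <= x)%R%:R - c <= f' w - w * f w].
Proof.
move=> k0 Fd F01 FNy Fy1 /andP[xc c1].
have c0 : 0 <= c by have /andP[F0 _] := F01 x; apply: le_trans (ltW xc).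
(* F has slope at most k, so it cannot exceed c before y. *)
pose y := x + (c - F x) / k.
have xy : x < y by rewrite ltrDl divr_gt0 // subr_gt0.
apply: (@stein_test_function_exists R k F k0 Fd F01 FNy Fy1 c x y) => //.
  by rewrite c0.
have [t _ E] := deriv_is_itv_MVT (fun z _ => Fd z) xy.
have : F y - F x <= k * (y - x).
  by rewrite E ler_wpM2r ?gauss_le // subr_ge0 ltW.
rewrite /y addrAC subrr add0r mulrCA mulfV ?gt_eqF // mulr1; lra.
Qed.

(** * The standard normal distribution function *)

Section StandardNormal.
Context (R : realType).

Definition std_normal_cdf (x : R) : R := fine (cdf (std_normal_variable (R := R)) x).

Lemma cdf_std_normal x : cdf (std_normal_variable (R := R)) x = (std_normal_cdf x)%:E.
Proof. by rewrite fineK // fin_num_measure. Qed.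

Lemma std_normal_cdf_01 x : 0 <= std_normal_cdf x <= 1.
Proof. by rewrite -!lee_fin -cdf_std_normal cdf_ge0 cdf_le1. Qed.

Lemma normal_peak1_gt0 : 0 < normal_peak (1 : R).
Proof.
by rewrite invr_gt0 sqrtr_gt0 expr1n mul1r mulrn_wgt0 // pi_gt0.
Qed.

Lemma normal_pdf1E : normal_pdf (0 : R) 1 = gauss (normal_peak 1).
Proof.
rewrite normal_pdfE ?oner_neq0 //; apply/funext => x.
by rewrite /normal_fun /gauss subr0 expr1n mulNr.
Qed.

Lemma deriv_is_std_normal_cdf : deriv_is std_normal_cdf (gauss (normal_peak 1)).
Proof.
move=> x; rewrite -normal_pdf1E.
have -> : std_normal_cdf = (fun y => \int[lebesgue_measure]_(t in `]-oo, y]) normal_pdf 0 1 t)%R.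
  by apply/funext => y.
have mI : lebesgue_measure.-integrable [set` Interval -oo%O (BRight (x + 1))]
    (EFin \o normal_pdf (0 : R) 1).
  apply: (@integrableS _ _ _ lebesgue_measure setT) => //.
  exact: integrable_normal_pdf.
have cx : {for x, continuous (normal_pdf (0 : R) 1)}.
  exact: (continuous_normal_pdf (oner_neq0 R)).
have x1 : x < x + 1 by rewrite ltrDl.
have [d1 d2] := continuous_FTC1 x1 mI (ltNyr x) cx.
by apply: (DeriveDef d1); rewrite -derive1E; exact: d2.
Qed.

Lemma std_normal_cdf_Ny0 e x : 0 < e -> exists2 w, w < x & std_normal_cdf w < e.
Proof.
move=> e0; have : std_normal_cdf w @[w --> -oo] --> (0 : R).
  exact: fine_cvg (cvg_cdfNy0 _).
move=> /cvgr_lt /(_ e e0) Fe.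
near (ninfty_nbhs R) => w; exists w; last by near: w.
by near: w; apply: nbhs_ninfty_lt; exact: num_real.
Unshelve. all: by end_near.
Qed.

Lemma std_normal_cdf_y1 e x : 0 < e -> exists2 w, x < w & 1 - std_normal_cdf w < e.
Proof.
move=> e0; have : std_normal_cdf w @[w --> +oo] --> (1 : R).
  exact: fine_cvg (cvg_cdfy1 _).
have e1 : 1 - e < 1 by rewrite ltrBlDr ltrDl.
move=> /cvgr_gt /(_ _ e1) Fe.
near (pinfty_nbhs R) => w; exists w; last by rewrite ltrBlDr -ltrBlDl; near: w.
by near: w; apply: nbhs_pinfty_gt; exact: num_real.
Unshelve. all: by end_near.
Qed.

Lemma std_normal_stein_test (c x : R) : std_normal_cdf x < c <= 1 ->
  exists (f f' : R -> R) (K : R),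
  [/\ forall v w, `|f w - f v - f' v * (w - v)| <= K * (w - v) ^+ 2,
      forall v w, `|f' w - f' v| <= K * `|w - v| &
      forall w : R, (w <= x)%R%:R - c <= f' w - w * f w].
Proof.
exact: (stein_test_function normal_peak1_gt0 deriv_is_std_normal_cdf
  std_normal_cdf_01 std_normal_cdf_Ny0 std_normal_cdf_y1).
Qed.

(** The previous construction is applied to the reflected distribution function 1 - Phi (-w), and
    its f is turned into -f (-w). The symmetry of Phi is thus never invoked. *)
Lemma std_normal_stein_testN (c x : R) : 1 - std_normal_cdf x < c <= 1 ->
  exists (f f' : R -> R) (K : R),
  [/\ forall v w, `|f w - f v - f' v * (w - v)| <= K * (w - v) ^+ 2,
      forall v w, `|f' w - f' v| <= K * `|w - v| &
      forall w : R, (x < w)%R%:R - c <= f' w - w * f w].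
Proof.
pose G w := 1 - std_normal_cdf (- w); rewrite -{1}[x]opprK => Gc.
have Gd : deriv_is G (gauss (normal_peak 1)).
  have := deriv_isB (deriv_is_cst 1) (deriv_is_comp deriv_is_std_normal_cdf
    (deriv_isB (deriv_is_cst 0) (@deriv_is_id R))).
  have -> : (fun x : R => 1 - std_normal_cdf (0 - x)) = G.
    by apply/funext => z; rewrite sub0r.
  by move/deriv_is_ext; apply => z; rewrite !sub0r gaussN mulrN1 opprK.
have G01 w : 0 <= G w <= 1 by have := std_normal_cdf_01 (- w); rewrite /G; lra.
have GNy e z : 0 < e -> exists2 w, w < z & G w < e.
  move=> /(std_normal_cdf_y1 (- z))[w zw we]; exists (- w); first by rewrite ltrNl.
  by rewrite /G opprK.
have Gy1 e z : 0 < e -> exists2 w, z < w & 1 - G w < e.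
  move=> /(std_normal_cdf_Ny0 (- z))[w zw we]; exists (- w); first by rewrite ltrNr.
  by rewrite /G opprK subKr.
have [f [f' [K [f_taylor f'_lip fx]]]] :=
  stein_test_function normal_peak1_gt0 Gd G01 GNy Gy1 Gc.
exists (fun w => - f (- w)), (fun w => f' (- w)), K; split=> [v w|v w|w].
- have := f_taylor (- v) (- w).
  have -> : - w - - v = - (w - v) by ring.
  rewrite sqrrN; apply: le_trans; rewrite -normrN le_eqVlt; apply/orP; left.
  by apply/eqP; congr (`|_|); ring.
- by have := f'_lip (- v) (- w); rewrite -opprD normrN.
- have := fx (- w); rewrite lerN2 mulNr mulrN; apply: le_trans.
  by have [xw|xw] := ltP x w; rewrite ?(ltW xw) // lerD2r ler0n.
Qed.

End StandardNormal.

(** * Asymptotics *)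

Section ProgressionCount.
Context (R : realType).

Definition ap_mean (n l : nat) (p : R) : R := #|APs n l|%:R * p ^+ l.
Definition ap_density (n l : nat) (p : R) : R := (l * (2 * n))%:R * p ^+ l.-1.

Let sqrt_small (p : R) : 0 < p <= 4^-1 -> 0 <= Num.sqrt p <= 2^-1.
Proof.
move=> /andP[p0 p4]; rewrite sqrtr_ge0 /= -(@ler_pXn2r _ 2) ?nnegrE ?sqrtr_ge0 //.
by rewrite (sqr_sqrtr (ltW p0)); apply: le_trans p4 _; rewrite exprVn; lra.
Qed.

(** A single constant (1 + C)^2 serves both bounds: it dominates C and (1 + C sqrt p)^2. The term 4
    l^4 is 4 l^2 times the codegree l^2. *)
Lemma AP_overlap_bounds : exists2 C : R, 0 <= C &
  forall n l p, (1 < l)%N -> 0 < p <= 4^-1 ->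
  overlap_sum p (APs n l) <= ap_mean n l p * (ap_density n l p + C * Num.sqrt p) /\
  cluster_sum p (APs n l) <= ap_mean n l p *
    (2 * (ap_density n l p * (ap_density n l p + 4 * l%:R ^+ 4)) + C).
Proof.
have [C C0 CP] := AP_overlap_sum R; exists ((1 + C) ^+ 2).
  by rewrite sqr_ge0.
move=> n l p l1 p4; have q2 := sqrt_small p4; have /andP[q0 q2'] := q2.
have p0 : 0 <= p by case/andP: p4 => /ltW.
have q01 : 0 <= Num.sqrt p <= 1 by apply/andP; split=> //; lra.
have pE : p = Num.sqrt p ^+ 2 by rewrite sqr_sqrtr.
have m0 : 0 <= ap_mean n l p by rewrite mulr_ge0 ?exprn_ge0.
have l0 := ltnW l1.
have overlap S : S \in APs n l -> \sum_(B in APs n l | (B != S) && (1 < #|S :&: B|)%N)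
   Num.sqrt p ^+ (l - #|S :&: B|) <= C * Num.sqrt p by exact: CP.
split.
  have := overlap_sum_le q01 pE (card_AP l1) (AP_degree l1) overlap l0.
  rewrite mulrA => /le_trans; apply; rewrite ler_wpM2l // lerD2l ler_wpM2r //.
  by nra.
have := cluster_sum_le q01 pE (card_AP l1) (AP_degree l1) (AP_codegree l1) overlap l0.
rewrite mulrA => /le_trans; apply; rewrite ler_wpM2l //; apply: lerD.
  by rewrite -mulnA -expnD [(4 * _)%:R]natrM natrX.
rewrite ler_sqr ?nnegrE; last 2 first.
- by rewrite addr_ge0 // mulr_ge0.
- by rewrite addr_ge0.
by rewrite lerD2l ler_piMr //; lra.
Qed.

Lemma ap_mean_bounds n l p : (1 < l)%N -> 0 <= p ->
  (n - l.-1)%:R ^+ 2 * p ^+ l <= 2 * l.-1%:R * ap_mean n l p <= n%:R ^+ 2 * p ^+ l.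
Proof.
move=> l1 p0; have /andP[lo up] := card_APs_bounds n l1.
by rewrite /ap_mean mulrA -!natrM -!natrX !ler_wpM2r ?exprn_ge0 // ler_nat.
Qed.

(** 34 = 2 + 32: the diagonal gives m <= 2 V, and the degree bound gives m D <= 32 V by means of n^2
    <= 8 l |F|. *)
Lemma AP_count_var_ge n l p : (1 < l)%N -> 0 < p <= 4^-1 -> (2 * l <= n)%N ->
  ap_mean n l p * (1 + ap_density n l p) <= 34 * count_var p (APs n l).
Proof.
move=> l1 /andP[p0 p4] ln; have p1 : 0 < p <= 1 by rewrite p0; lra.
have l0 := ltnW l1; have [p0' p1'] := (ltW p0, (andP p1).2).
have m0 : 0 <= ap_mean n l p by rewrite mulr_ge0 ?exprn_ge0.
have V1 : ap_mean n l p <= 2 * count_var p (APs n l).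
  have := count_var_ge_diag p1 (@card_AP n l l1) l0; rewrite mulrA -/(ap_mean n l p).
  have : p ^+ l <= 2^-1 by apply: le_trans (_ : p ^+ 1 <= _); rewrite ?ler_wiXn2l ?expr1 //; lra.
  by move: (p ^+ l) => t t2; nra.
have n0 : 0 < n%:R :> R by rewrite ltr0n; lia.
have N0 : (n ^ 2 <= 8 * l * #|APs n l|)%N.
  have /andP[lo _] := card_APs_bounds n l1.
  have : (n <= 2 * (n - l.-1))%N by lia.
  move: (#|APs n l|) lo => N lo h; nia.
have V2 : ap_mean n l p * ap_density n l p <= 32 * count_var p (APs n l).
  rewrite -(ler_pM2l n0).
  have := count_var_ge_proj p1 (@card_AP n l l1) l0; rewrite card_ord.
  set V := count_var _ _ => VP.
  have -> : n%:R * (32 * V) = 32 * (n%:R * V) by ring.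
  apply: le_trans (ler_wpM2l _ VP) => //.
  rewrite /ap_mean /ap_density [(_ * l)%:R]natrM exprMn exprD.
  set N := #|APs n l|%:R.
  have -> : n%:R * (N * p ^+ l * ((l * (2 * n))%:R * p ^+ l.-1)) =
    2 * l%:R * N * (p ^+ l * p ^+ l.-1) * n%:R ^+ 2 by rewrite !natrM; ring.
  have -> : 32 * (N ^+ 2 * l%:R ^+ 2 * (p ^+ l * p ^+ l.-1 * (1 - p))) =
    2 * l%:R * N * (p ^+ l * p ^+ l.-1) * (16 * (1 - p) * l%:R * N) by ring.
  rewrite ler_wpM2l ?mulr_ge0 ?exprn_ge0 //.
  apply: (@le_trans _ _ (8 * l%:R * N)).
    by rewrite -!natrM -natrX ler_nat.
  rewrite !ler_wpM2r //; lra.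
by lra.
Qed.

End ProgressionCount.

(** Squaring T avoids the square root of V; the 3 is Cauchy-Schwarz for the summands 2 D^2, 8 L D
    and C. In B, the terms 4 D^4 and 64 L^2 D^2 keep one factor D and leave at most D^3 and D to (1
    + D)^3, whence 68 L^2 D. *)
Lemma cluster_variance_ratio (R : realFieldType) (m D L C T V : R) :
    0 < m -> 0 <= D -> 1 <= L -> 0 <= C -> 0 <= T ->
    T <= m * (2 * (D * (D + 4 * L)) + C) -> m * (1 + D) <= 34 * V ->
  T ^+ 2 / V ^+ 3 <= 34 ^+ 3 * 3 * ((68 * L ^+ 2 * D + C ^+ 2) / m).
Proof.
move=> m0 D0 L1 C0 T0 T_le V_ge; have D1 : 0 < 1 + D by lra.
have mD : 0 < m * (1 + D) by rewrite mulr_gt0.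
have V0 : 0 < V by lra.
have L0 : 0 <= L by lra.
set B := 4 * D ^+ 4 + 64 * L ^+ 2 * D ^+ 2 + C ^+ 2.
have T2 : T ^+ 2 <= m ^+ 2 * (3 * B).
  apply: (@le_trans _ _ ((m * (2 * (D * (D + 4 * L)) + C)) ^+ 2)).
    by rewrite lerXn2r ?nnegrE // (le_trans T0).
  rewrite exprMn ler_wpM2l ?sqr_ge0 // /B.
  have := sqr_ge0 (2 * D ^+ 2 - 8 * L * D); have := sqr_ge0 (2 * D ^+ 2 - C).
  by have := sqr_ge0 (8 * L * D - C); lra.
have B_le : B <= (68 * L ^+ 2 * D + C ^+ 2) * (1 + D) ^+ 3.
  have D2 : 0 <= D ^+ 2 by rewrite sqr_ge0.
  have D3 : 0 <= D ^+ 3 by rewrite exprn_ge0.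
  have E : (1 + D) ^+ 3 = 1 + 3 * D + 3 * D ^+ 2 + D ^+ 3 by ring.
  have LD : 0 <= L ^+ 2 * D by rewrite mulr_ge0 ?sqr_ge0.
  have LD1 : D <= L ^+ 2 * D by rewrite ler_peMl // expr_ge1.
  have a1 : D <= (1 + D) ^+ 3 by lra.
  have a2 : D ^+ 3 <= (1 + D) ^+ 3 by lra.
  have a3 : 1 <= (1 + D) ^+ 3 by lra.
  have b1 := ler_wpM2l LD a1; have b2 := ler_wpM2l LD a2.
  have b3 := ler_wpM2l (sqr_ge0 C) a3; have b4 := ler_wpM2r D3 LD1.
  by rewrite /B; move: b1 b2 b3 b4; lra.
rewrite ler_pdivrMr ?exprn_gt0 //; apply: le_trans T2 _.
have V3 : (m * (1 + D)) ^+ 3 <= (34 * V) ^+ 3.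
  by rewrite lerXn2r ?nnegrE ?(ltW mD) ?mulr_ge0 ?(ltW V0).
have -> : 34 ^+ 3 * 3 * ((68 * L ^+ 2 * D + C ^+ 2) / m) * V ^+ 3 =
  3 * (68 * L ^+ 2 * D + C ^+ 2) / m * (34 * V) ^+ 3 by rewrite [(34 * V) ^+ 3]exprMn; ring.
apply: (@le_trans _ _ (3 * (68 * L ^+ 2 * D + C ^+ 2) / m * (m * (1 + D)) ^+ 3)).
  have -> : 3 * (68 * L ^+ 2 * D + C ^+ 2) / m * (m * (1 + D)) ^+ 3 =
     m ^+ 2 * (3 * ((68 * L ^+ 2 * D + C ^+ 2) * (1 + D) ^+ 3)).
    by field; rewrite gt_eqF.
  by rewrite ler_wpM2l ?sqr_ge0 // ler_wpM2l.
rewrite ler_wpM2l // divr_ge0 ?(ltW m0) // mulr_ge0 // addr_ge0 ?sqr_ge0 //.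
by rewrite !mulr_ge0 ?sqr_ge0.
Qed.

Section Asymptotics.
Context (R : realType).

Lemma cvg0_squeeze (f g : nat -> R) : (\forall n \near \oo, 0 <= f n <= g n) ->
  g n @[n --> \oo] --> (0 : R) -> f n @[n --> \oo] --> (0 : R).
Proof. by move=> fg g0; apply: (squeeze_cvgr fg) => //; exact: cvg_cst. Qed.

Lemma cvg0_root (f : nat -> R) k :
  f n ^+ k.+1 @[n --> \oo] --> (0 : R) -> f n @[n --> \oo] --> (0 : R).
Proof.
move=> /cvgr0Pnorm_lt fk; apply/cvgr0Pnorm_lt => e e0.
have ek : 0 < e ^+ k.+1 by rewrite exprn_gt0.
near=> n; rewrite -(@ltr_pXn2r _ k.+1) ?nnegrE ?(ltW e0) //.
by rewrite -normrX; near: n; exact: fk.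
Unshelve. all: by end_near.
Qed.

Lemma ln_natr_cvgy : ln (n%:R : R) @[n --> \oo] --> +oo.
Proof.
apply/cvgryPge => A; near=> n.
rewrite -[A]expRK ler_ln ?posrE ?expR_gt0 //; last by rewrite ltr0n; near: n; exact: nbhs_infty_gt.
near: n; exact: nbhs_infty_ger.
Unshelve. all: by end_near.
Qed.

(** One term of the exponential series gives n >= u^(k+1) / (k+1)! with u = ln n, so the quotient is
    at most (k+1)! / u. *)
Lemma ln_pow_div_natr_cvg0 k : ln (n%:R : R) ^+ k / n%:R @[n --> \oo] --> (0 : R).
Proof.
pose c : R := k.+1`!%:R.
apply: (@cvg0_squeeze _ (fun n => c * (ln n%:R)^-1)); last first.
  rewrite -(mulr0 c); apply: cvgM; [exact: cvg_cst|]; apply/gtr0_cvgV0; last exact: ln_natr_cvgy.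
  near=> n; rewrite ln_gt0 // ltr1n; near: n; exact: nbhs_infty_gt.
near=> n.
have n1 : (1 < n)%N by near: n; exact: nbhs_infty_gt.
have u0 : 0 < ln (n%:R : R) by rewrite ln_gt0 // ltr1n.
have n0 : 0 < n%:R :> R by rewrite ltr0n (ltn_trans _ n1).
rewrite divr_ge0 ?exprn_ge0 ?(ltW u0) ?(ltW n0) //= ler_pdivrMr // mulrAC.
rewrite ler_pdivlMr // mulrC -exprS.
have := @expR_ge1Dxn R (ln n%:R) k (ltW u0); rewrite lnK ?posrE // => h.
have c0 : 0 < c by rewrite ltr0n fact_gt0.
have : ln n%:R ^+ k.+1 / c <= n%:R by move: h; rewrite -/c; lra.
by rewrite ler_pdivrMr // mulrC.
Unshelve. all: by end_near.
Qed.

Context (l : nat -> nat) (p : nat -> R).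
Hypothesis l_ge3 : forall n, (3 <= l n)%N.
Hypothesis l_const_or_slow : (exists l0, forall n, l n = l0) \/
      (l n @[n --> \oo] --> \oo /\
       (l n)%:R / ln n%:R @[n --> \oo] --> (0 : R)).
Hypothesis p_itv : forall n, 0 < p n <= 1.
Hypothesis p_to0 : p n @[n --> \oo] --> (0 : R).

Lemma length_pow_cvg0 k : (l n)%:R ^+ k / n%:R @[n --> \oo] --> (0 : R).
Proof.
have [[l0 lE]|[_ slow]] := l_const_or_slow.
  under eq_fun do rewrite lE.
  rewrite -(mulr0 (l0%:R ^+ k)); apply: cvgM; [exact: cvg_cst|].
  apply/gtr0_cvgV0; last exact: cvgr_idn.
  by near=> n; rewrite ltr0n; near: n; exact: nbhs_infty_gt.
apply: cvg0_squeeze (ln_pow_div_natr_cvg0 k); near=> n.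
have n1 : (1 < n)%N by near: n; exact: nbhs_infty_gt.
have u0 : 0 < ln (n%:R : R) by rewrite ln_gt0 // ltr1n.
have lu : (l n)%:R <= ln n%:R :> R.
  rewrite -[leRHS]mul1r -ler_pdivrMr //; near: n.
  move/cvgr_le : slow => /(_ 1 ltr01); apply.
rewrite divr_ge0 ?exprn_ge0 //= ler_wpM2r ?invr_ge0 //.
by rewrite lerXn2r ?nnegrE ?ler0n ?(ltW u0).
Unshelve. all: by end_near.
Qed.

Definition kappa n : R := n%:R ^+ 2 * p n ^+ l n / ((l n)%:R - 1).

(** Since l >= 3 and p <= 1, d <= kappa <= n^2 p^3, hence (n p)^3 >= d n. The cube of the quotient
    is therefore at most l^(3k) / (d n). *)
Lemma length_pow_mean_cvg0 (d : R) k : 0 < d -> (\forall n \near \oo, d <= kappa n) ->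
  (l n)%:R ^+ k / (n%:R * p n) @[n --> \oo] --> (0 : R).
Proof.
move=> d0 dk; apply: (@cvg0_root _ 2).
apply: (@cvg0_squeeze _ (fun n => d^-1 * ((l n)%:R ^+ (k * 3) / n%:R))); last first.
  by rewrite -(mulr0 d^-1); apply: cvgM; [exact: cvg_cst|exact: length_pow_cvg0].
near=> n; have /andP[p0 p1] := p_itv n.
have n0 : 0 < n%:R :> R by rewrite ltr0n; near: n; exact: nbhs_infty_gt.
have np0 : 0 < n%:R * p n by rewrite mulr_gt0.
rewrite exprn_ge0 ?divr_ge0 ?exprn_ge0 ?(ltW np0) //= expr_div_n -exprM.
rewrite mulrCA ler_wpM2l ?exprn_ge0 // -invfM lef_pV2 ?posrE ?mulr_gt0 ?exprn_gt0 //.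
have dn : d <= kappa n by near: n.
have l3 : 1 <= (l n)%:R - 1 :> R.
  by have : 2%:R <= (l n)%:R :> R; [rewrite ler_nat ltnW | lra].
have pl : p n ^+ l n <= p n ^+ 3 by apply: ler_wiXn2l => //; exact: ltW.
have : d <= n%:R ^+ 2 * p n ^+ 3.
  apply: le_trans dn _; rewrite /kappa ler_pdivrMr; last by lra.
  apply: (@le_trans _ _ (n%:R ^+ 2 * p n ^+ 3)); first by rewrite ler_wpM2l ?sqr_ge0.
  by rewrite ler_peMr // mulr_ge0 ?sqr_ge0 ?exprn_ge0 // ltW.
have -> : (n%:R * p n) ^+ 3 = (n%:R ^+ 2 * p n ^+ 3) * n%:R by ring.
by rewrite ler_pM2r.
Unshelve. all: by end_near.
Qed.

Let mu n := ap_mean n (l n) (p n).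
Let dens n := ap_density n (l n) (p n).

Let p_gt0 n : 0 < p n. Proof. by case/andP: (p_itv n). Qed.

Let l_gt1 n : (1 < l n)%N. Proof. exact: ltnW. Qed.

Let l_pred n : (l n).-1%:R = (l n)%:R - 1 :> R.
Proof. by rewrite -subn1 natrB // (ltn_trans _ (l_gt1 n)). Qed.

Let l_pred_gt0 n : 0 < (l n)%:R - 1 :> R.
Proof. by rewrite -l_pred ltr0n -subn1 subn_gt0. Qed.

Let kappa_gt0 n : (0 < n)%N -> 0 < kappa n.
Proof.
by move=> n0; rewrite divr_gt0 // mulr_gt0 ?exprn_gt0 // ltr0n.
Qed.

(** The bounds on the number of progressions enclose the ratio between (1 - l / n)^2 / 2 and 1 /
    2. *)
Lemma mean_kappa_cvg : mu n / kappa n @[n --> \oo] --> (2^-1 : R).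
Proof.
pose r n : R := 1 - (l n)%:R ^+ 1 / n%:R.
have r1 : r n @[n --> \oo] --> (1 : R).
  by rewrite -[X in _ --> X]subr0; apply: cvgB; [exact: cvg_cst | exact: length_pow_cvg0].
have r2 : 2^-1 * r n ^+ 2 @[n --> \oo] --> (2^-1 : R).
  rewrite -[X in _ --> X]mulr1; apply: cvgM; first exact: cvg_cst.
  by rewrite -[X in _ --> X](mulr1 1); apply: cvgM.
have half : (fun=> 2^-1 : R) n @[n --> \oo] --> (2^-1 : R) by exact: cvg_cst.
apply: (squeeze_cvgr _ r2 half); near=> n.
have n0 : (0 < n)%N by near: n; exact: nbhs_infty_gt.
have n0R : 0 < n%:R :> R by rewrite ltr0n.
have r0 : 0 < r n by near: n; exact: (cvgr_gt _ r1).
have k0 := kappa_gt0 n0; have := ap_mean_bounds n (l_gt1 n) (ltW (p_gt0 n)).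
have kE : n%:R ^+ 2 * p n ^+ l n = kappa n * ((l n)%:R - 1).
  by rewrite /kappa mulfVK // gt_eqF.
have l0 := l_pred_gt0 n.
have nr : 0 <= n%:R * r n <= (n - (l n).-1)%:R.
  rewrite mulr_ge0 ?(ltW n0R) ?(ltW r0) //= /r expr1 mulrBr mulr1 mulrCA mulfV ?gt_eqF // mulr1.
  rewrite lerBlDr -natrD ler_nat; lia.
have pl : 0 < p n ^+ l n by rewrite exprn_gt0.
rewrite l_pred kE -/(mu n) => /andP[lo up].
rewrite ler_pdivlMr // ler_pdivrMr //; apply/andP; split; last first.
  by rewrite -(ler_pM2r l0); move: up; lra.
rewrite -(ler_pM2r l0).
have : (n%:R * r n) ^+ 2 * p n ^+ l n <= (n - (l n).-1)%:R ^+ 2 * p n ^+ l n.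
  by rewrite ler_wpM2r ?(ltW pl) // lerXn2r ?nnegrE //; case/andP: nr.
rewrite exprMn -mulrA [r n ^+ 2 * _]mulrC mulrA kE.
by move: lo; move: (r n ^+ 2) => rr; lra.
Unshelve. all: by end_near.
Qed.

Lemma mean_cvg (c : R) : kappa n @[n --> \oo] --> c -> mu n @[n --> \oo] --> c / 2.
Proof.
move=> kc; apply: cvg_trans (cvgM kc mean_kappa_cvg).
apply: near_eq_cvg; near=> n.
rewrite /= mulrC divfK // gt_eqF // kappa_gt0 //.
by near: n; exact: nbhs_infty_gt.
Unshelve. all: by end_near.
Qed.

Lemma mean_cvgy : kappa n @[n --> \oo] --> +oo -> mu n @[n --> \oo] --> +oo.
Proof.
move=> /cvgryPge ky; apply/cvgryPge => B; near=> n.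
have n0 : (0 < n)%N by near: n; exact: nbhs_infty_gt.
have k0 := kappa_gt0 n0.
have : 4^-1 <= mu n / kappa n.
  near: n; apply: (cvgr_ge _ mean_kappa_cvg); lra.
rewrite [_ <= mu n / _]ler_pdivlMr // => h.
have : 4 * B <= kappa n by near: n; exact: ky.
by move: h; move: (mu n) (kappa n) => u v; lra.
Unshelve. all: by end_near.
Qed.

Lemma density_kappaE n : (0 < n)%N ->
  dens n = 2 * kappa n * (((l n)%:R - 1) * (l n)%:R / (n%:R * p n)).
Proof.
move=> n0; have n0R : n%:R != 0 :> R by rewrite pnatr_eq0 -lt0n.
have p0 : p n != 0 by rewrite gt_eqF.
have l0 : (l n)%:R - 1 != 0 :> R by rewrite gt_eqF.
rewrite /dens /ap_density /kappa; have -> : p n ^+ l n = p n * p n ^+ (l n).-1.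
  by rewrite -exprS prednK // (ltn_trans _ (l_gt1 n)).
rewrite !natrM; move: (p n ^+ _) => t.
by field; rewrite n0R p0 l0.
Qed.

Lemma density_cvg0 (c : R) : 0 < c -> kappa n @[n --> \oo] --> c ->
  dens n @[n --> \oo] --> (0 : R).
Proof.
move=> c0 kc; pose g n := 2 * kappa n * ((l n)%:R ^+ 2 / (n%:R * p n)).
have kge : \forall n \near \oo, c / 2 <= kappa n by apply: (cvgr_ge _ kc); lra.
have c2 : 0 < c / 2 by rewrite divr_gt0.
have g0 : g n @[n --> \oo] --> (0 : R).
  rewrite -(mulr0 (2 * c)); apply: cvgM; last exact: length_pow_mean_cvg0 c2 kge.
  by apply: cvgM => //; exact: cvg_cst.
apply: (cvg0_squeeze _ g0); near=> n.
have n0 : (0 < n)%N by near: n; exact: nbhs_infty_gt.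
have k0 := kappa_gt0 n0; have l0 := l_pred_gt0 n.
have np0 : 0 < n%:R * p n by rewrite mulr_gt0 ?ltr0n.
have a0 : 0 <= 2 * kappa n by rewrite pmulr_rge0 // ltW.
have b0 : 0 <= (n%:R * p n)^-1 by rewrite invr_ge0 ltW.
rewrite density_kappaE // /g (mulr_ge0 a0) /=; last first.
  by rewrite (mulr_ge0 _ b0) // mulr_ge0 // ltW.
rewrite (ler_wpM2l a0) // (ler_wpM2r b0) //.
by rewrite expr2 ler_wpM2r // gerBl.
Unshelve. all: by end_near.
Qed.

Lemma sqrt_p_cvg0 : Num.sqrt (p n) @[n --> \oo] --> (0 : R).
Proof.
apply: (@cvg0_root _ 1).
by under eq_fun do rewrite sqr_sqrtr ?(ltW (p_gt0 _)) //.
Qed.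

Let var n := count_var (p n) (APs n (l n)).

Let eventually_small : \forall n \near \oo, 0 < p n <= 4^-1 /\ (2 * l n <= n)%N.
Proof.
near=> n; have n0 : 0 < n%:R :> R.
  by rewrite ltr0n; near: n; exact: nbhs_infty_gt.
rewrite p_gt0 /=; split.
  by near: n; apply: (cvgr_le _ p_to0); rewrite invr_gt0.
have : (l n)%:R ^+ 1 / n%:R <= 2^-1 :> R.
  by near: n; apply: (cvgr_le _ (length_pow_cvg0 1)); rewrite invr_gt0.
rewrite expr1 ler_pdivrMr // => h; rewrite -(ler_nat R) natrM.
by move: h; lra.
Unshelve. all: by end_near.
Qed.

Lemma count_var_gt0 : \forall n \near \oo, 0 < var n.
Proof.
near=> n.
have n0 : (0 < n)%N by near: n; exact: nbhs_infty_gt.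
have [p4 ln] : 0 < p n <= 4^-1 /\ (2 * l n <= n)%N by near: n; exact: eventually_small.
have := AP_count_var_ge (l_gt1 n) p4 ln; rewrite -/(mu n) -/(var n) -/(dens n).
have mu0 : 0 < mu n.
  have /andP[lo _] := ap_mean_bounds n (l_gt1 n) (ltW (p_gt0 n)).
  have : 0 < 2 * (l n).-1%:R * ap_mean n (l n) (p n).
    apply: lt_le_trans lo; rewrite mulr_gt0 ?exprn_gt0 // ltr0n; lia.
  by rewrite pmulr_rgt0 // mulr_gt0 // l_pred.
have dens0 : 0 <= dens n by rewrite mulr_ge0 ?exprn_ge0 // ltW.
have : 0 < mu n * (1 + dens n) by rewrite mulr_gt0 // ltr_pwDl.
by move: (mu n * _) (var n) => u v; lra.
Unshelve. all: by end_near.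
Qed.

Lemma cluster_ratio_cvg0 : kappa n @[n --> \oo] --> +oo ->
  (Num.sqrt (var n))^-1 ^+ 3 * cluster_sum (p n) (APs n (l n)) @[n --> \oo] --> (0 : R).
Proof.
move=> ky; have [C C0 CP] := AP_overlap_bounds R.
have muy := mean_cvgy ky.
apply: (@cvg0_root _ 1).
(* The exponent 10 is 8 from L^2 with L = l^4, plus 2 from the density; the 8 comes from D <= 2
   kappa l^2 / (n p) and kappa <= 4 mu. *)
pose y n := 34 ^+ 3 * 3 * (68 * (8 * ((l n)%:R ^+ 10 / (n%:R * p n))) + C ^+ 2 * (mu n)^-1).
have k1 : \forall n \near \oo, 1 <= kappa n by move/cvgryPge : ky; apply.
have y0 : y n @[n --> \oo] --> (0 : R).
  rewrite -(mulr0 (34 ^+ 3 * 3)); apply: cvgM; first exact: cvg_cst.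
  rewrite -[X in _ --> X](addr0 0); apply: cvgD.
    rewrite -(mulr0 68); apply: cvgM; first exact: cvg_cst.
    rewrite -(mulr0 8); apply: cvgM; first exact: cvg_cst.
    exact: length_pow_mean_cvg0 ltr01 k1.
  rewrite -(mulr0 (C ^+ 2)); apply: cvgM; first exact: cvg_cst.
  apply/gtr0_cvgV0 => //.
  by move/cvgryPgt : muy; apply.
apply: (cvg0_squeeze _ y0); near=> n.
have n0 : (0 < n)%N by near: n; exact: nbhs_infty_gt.
have [p4 ln] : 0 < p n <= 4^-1 /\ (2 * l n <= n)%N by near: n; exact: eventually_small.
have v0 : 0 < var n by near: n; exact: count_var_gt0.
have mu0 : 0 < mu n by near: n; move/cvgryPgt : muy; apply.
have dens0 : 0 <= dens n by rewrite mulr_ge0 ?exprn_ge0 // ltW.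
have L1 : 1 <= (l n)%:R ^+ 4 :> R by rewrite exprn_ege1 // ler1n ltnW.
have T0 : 0 <= cluster_sum (p n) (APs n (l n)).
  by rewrite /cluster_sum; do 3 (apply: sumr_ge0 => ? _); rewrite exprn_ge0 // ltW.
have [_ T_le] := CP n (l n) (p n) (l_gt1 n) p4.
have V_ge := AP_count_var_ge (l_gt1 n) p4 ln.
have ratio := cluster_variance_ratio mu0 dens0 L1 C0 T0 T_le V_ge.
rewrite sqr_ge0 /=.
have -> : ((Num.sqrt (var n))^-1 ^+ 3 * cluster_sum (p n) (APs n (l n))) ^+ 2 =
  cluster_sum (p n) (APs n (l n)) ^+ 2 / var n ^+ 3.
  by rewrite exprMn mulrC -exprM mulnC exprM exprVn sqr_sqrtr ?(ltW v0) // exprVn.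
apply: le_trans ratio _.
have muk : 4^-1 * kappa n <= mu n.
  rewrite -ler_pdivlMr ?kappa_gt0 //; near: n; apply: (cvgr_ge _ mean_kappa_cvg).
  by lra.
have np0 : 0 < n%:R * p n by rewrite mulr_gt0 ?ltr0n.
have dens_le : dens n <= mu n * (8 * ((l n)%:R ^+ 2 / (n%:R * p n))).
  have ll : 0 <= ((l n)%:R - 1) * (l n)%:R / (n%:R * p n) <= (l n)%:R ^+ 2 / (n%:R * p n).
    rewrite divr_ge0 ?(ltW np0) ?mulr_ge0 ?(ltW (l_pred_gt0 n)) //=.
    by rewrite ler_wpM2r ?invr_ge0 ?(ltW np0) // expr2 ler_wpM2r // gerBl.
  rewrite density_kappaE //.
  move: (_ / _) (_ / (n%:R * p n)) ll muk (kappa_gt0 n0) mu0 => u v /andP[u0 uv].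
  move: (kappa n) (mu n) => k m h k0 m0; nra.
rewrite /y ler_wpM2l ?mulr_ge0 ?exprn_ge0 // mulrDl lerD2r.
rewrite -/(dens n) -/(mu n).
have -> : 68 * (l n)%:R ^+ 4 ^+ 2 * dens n / mu n =
  68 * ((l n)%:R ^+ 4 ^+ 2 * (dens n / mu n)).
  by move: (dens n) (mu n)^-1 => u v; ring.
rewrite ler_wpM2l //.
have -> : 8 * ((l n)%:R ^+ 10 / (n%:R * p n)) =
  (l n)%:R ^+ 4 ^+ 2 * ((mu n * (8 * ((l n)%:R ^+ 2 / (n%:R * p n)))) / mu n).
  by move: ((n%:R * p n)^-1) => z; field; rewrite gt_eqF.
have mu0' : 0 <= (mu n)^-1 by rewrite invr_ge0 ltW.
by rewrite ler_wpM2l ?sqr_ge0 // (ler_wpM2r mu0').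
Unshelve. all: by end_near.
Qed.

End Asymptotics.

(** * Laws of the count and of its standardization *)

Section ProgressionLaw.
Context d (T : measurableType d) (R : realType) (P : probability T R).
Context (n l : nat) (p : R) (A : {RV P >-> {set 'I_n}}).
Hypothesis A_binomial : binomial_random_set p A.
Hypothesis p01 : 0 < p <= 1.
Hypothesis l_gt1 : (1 < l)%N.

Let F := APs n l.

Lemma cdf_AP_count x : cdf (AP_count l A : {RV P >-> R}) x =
  (mean p (fun S => ((edge_count F S)%:R <= x)%R%:R))%:E.
Proof.
rewrite -(prob_binomial_random_set A_binomial (fun S => ((edge_count F S)%:R <= x))).
congr (P _); apply/seteqP; split=> w /=; rewrite in_itv /= /AP_count /edge_count natr_sum //.
Qed.

Let centred1E (S : {set 'I_n}) : \sum_(a in F) (a \subset S)%:R - \sum_(a in F) p ^+ #|a| =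
  centred_sum p 1 F S.
Proof. by rewrite -sumrB; apply: eq_bigr => a _; rewrite /centred mul1r. Qed.

Let AP_countE :
  AP_count l A = (fun S : {set 'I_n} => \sum_(a in F) (a \subset S)%:R) \o A :> (T -> R).
Proof. by []. Qed.

Let expectation_AP_count : ('E_P[AP_count l A] = (\sum_(a in F) p ^+ #|a|)%:E)%E.
Proof.
rewrite AP_countE (expectation_binomial_random_set A_binomial) mean_sum.
by congr EFin; apply: eq_bigr => a _; rewrite mean_subset.
Qed.

Let variance_AP_count : ('V_P[AP_count l A] = (count_var p F)%:E)%E.
Proof.
rewrite /variance unlock expectation_AP_count /=.
rewrite /count_var -(expectation_binomial_random_set A_binomial).
congr expectation.body; apply/funext => w.
by rewrite /= -centred1E -expr2.
Qed.

Lemma cdf_standardize_AP_count x :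
  cdf (standardize (AP_count l A : {RV P >-> R}) : {RV P >-> R}) x =
  (mean p (fun S => (centred_sum p (Num.sqrt (count_var p F))^-1 F S <= x)%R%:R))%:E.
Proof.
rewrite -(prob_binomial_random_set A_binomial
  (fun S => centred_sum p (Num.sqrt (count_var p F))^-1 F S <= x)).
have stdE w : standardize (AP_count l A : {RV P >-> R}) w =
    centred_sum p (Num.sqrt (count_var p F))^-1 F (A w).
  rewrite /standardize variance_AP_count expectation_AP_count /= centred1E.
  by rewrite mulrC /centred_sum mulr_sumr; apply: eq_bigr => a _; rewrite /centred mul1r.
by congr (P _); apply/seteqP; split=> w /=; rewrite in_itv /= stdE.
Qed.

Lemma poisson_AP_count (lambda : R) (h : pred nat) : 0 < lambda ->
  `|mean p (fun S => (h (edge_count F S))%:R) -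
    fine (poisson_prob lambda 0 [set k | h k])|
  <= expR lambda * (`|lambda - ap_mean n l p| + 4 * overlap_sum p F +
       2 * (ap_mean n l p * p)).
Proof.
move=> lambda0; have /andP[p0 p1] := p01.
have p01' : 0 <= p <= 1 by rewrite ltW.
have F0 : finset.set0 \notin F.
  by apply/negP => /(card_AP l_gt1); rewrite cards0; lia.
apply: le_trans (poisson_approximation h p01' F0 lambda0) _.
rewrite ler_wpM2l ?expR_ge0 //.
have mE : \sum_(a in F) p ^+ #|a| = ap_mean n l p.
  rewrite (eq_bigr (fun=> p ^+ l)) => [|a aF]; last by rewrite (card_AP l_gt1 aF).
  by rewrite sumr_const -mulr_natl.
rewrite mE lerD2l ler_wpM2l // -mE mulr_suml; apply: ler_sum => a aF.
rewrite exprD ler_wpM2l ?exprn_ge0 ?(ltW p0) // (card_AP l_gt1 aF).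
by rewrite -[leRHS]expr1; apply: ler_wiXn2l; rewrite ?(ltW p0) // ltnW.
Qed.

Lemma normal_AP_count (f f' : R -> R) (K : R) :
    0 < count_var p F ->
    (forall v w, `|f w - f v - f' v * (w - v)| <= K * (w - v) ^+ 2) ->
    (forall v w, `|f' w - f' v| <= K * `|w - v|) ->
  let s := (Num.sqrt (count_var p F))^-1 in
  `|mean p (fun S => f' (centred_sum p s F S) -
                     centred_sum p s F S * f (centred_sum p s F S))|
    <= 40 * K * (s ^+ 3 * cluster_sum p F).
Proof.
move=> V0 f_taylor f'_lip /=; set s := (Num.sqrt _)^-1; have /andP[p0 p1] := p01.
have p01' : 0 <= p <= 1 by rewrite ltW.
have s0 : 0 <= s by rewrite invr_ge0 sqrtr_ge0.
rewrite mulrA; apply: stein_local_dependence => //.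
have sE S : centred_sum p s F S ^+ 2 = s ^+ 2 * centred_sum p 1 F S ^+ 2.
  rewrite -exprMn /centred_sum mulr_sumr; congr (_ ^+ 2).
  by apply: eq_bigr => a _; rewrite /centred mul1r.
rewrite (eq_mean p sE) meanZl -/(count_var p F) /s exprVn sqr_sqrtr ?(ltW V0) //.
by rewrite mulVf // gt_eqF.
Qed.

End ProgressionLaw.

Lemma cdf_poisson_variable (R : realType) (lambda x : R) :
  cdf (poisson_variable lambda) x =
  (fine (poisson_prob lambda 0 [set k | (k%:R <= x)%R]))%:E.
Proof.
have -> : poisson_prob lambda 0 [set k | (k%:R <= x)%R] = cdf (poisson_variable lambda) x.
  by congr (poisson_prob lambda 0 _); apply/seteqP; split=> k /=; rewrite in_itv.
by rewrite fineK // fin_num_measure.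
Qed.

Lemma cvg0_le_eventually (R : realType) (u : nat -> R) (K e : R) : 0 < e ->
  u n @[n --> \oo] --> (0 : R) -> \forall n \near \oo, K * u n <= e.
Proof.
move=> e0 u0; have Ku : K * u n @[n --> \oo] --> (0 : R).
  by rewrite -(mulr0 K); apply: cvgM => //; exact: cvg_cst.
by apply: (cvgr_le _ Ku).
Qed.

Unset Implicit Arguments.

Theorem theorem1 (R : realType) (l : nat -> nat) (p : nat -> R)
    (d : nat -> measure_display) (T : forall n, measurableType (d n))
    (P : forall n, probability (T n) R)
    (A : forall n, {RV (P n) >-> {set 'I_n}})
    (l_ge3 : forall n, (3 <= l n)%N)
    (l_const_or_slow :
      (exists l0, forall n, l n = l0) \/
      (l n @[n --> \oo] --> \oo /\
       (l n)%:R / ln n%:R @[n --> \oo] --> (0 : R)))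
    (p_itv : forall n, 0 < p n <= 1)
    (p_to0 : p n @[n --> \oo] --> (0 : R))
    (A_binomial : forall n, binomial_random_set (p n) (A n)) :
  (forall c : R, 0 < c ->
     n%:R ^+ 2 * p n ^+ l n / ((l n)%:R - 1) @[n --> \oo] --> c ->
     cvg_in_distribution (fun n => AP_count (l n) (A n) : {RV (P n) >-> R})
       (poisson_variable (c / 2))) /\
  (n%:R ^+ 2 * p n ^+ l n / ((l n)%:R - 1) @[n --> \oo] --> +oo ->
     cvg_in_distribution
       (fun n => standardize (AP_count (l n) (A n) : {RV (P n) >-> R})
                   : {RV (P n) >-> R})
       std_normal_variable).
Proof.
have l_gt1 n : (1 < l n)%N by exact: ltnW.
split=> [c c0 kc x _ | ky x _].
  have l0 : 0 < c / 2 by rewrite divr_gt0.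
  under eq_fun do rewrite (cdf_AP_count _ (A_binomial _)).
  rewrite cdf_poisson_variable; apply/fine_cvgP; split; first exact: nearW.
  rewrite /comp /=; have [C C0 CP] := AP_overlap_bounds R.
  pose m n := ap_mean n (l n) (p n); pose D n := ap_density n (l n) (p n).
  pose err n := expR (c / 2) * (`|c / 2 - m n| +
    4 * (m n * (D n + C * Num.sqrt (p n))) + 2 * (m n * p n)).
  have mc : m n @[n --> \oo] --> c / 2 by exact: mean_cvg kc.
  have err0 : err n @[n --> \oo] --> (0 : R).
    have -> : (0 : R) = expR (c / 2) * (`|c / 2 - c / 2| +
        4 * (c / 2 * (0 + C * 0)) + 2 * (c / 2 * 0)).
      by rewrite subrr normr0; ring.
    apply: cvgM; first exact: cvg_cst.
    apply: cvgD; last by apply: cvgM; [exact: cvg_cst | exact: cvgM].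
    apply: cvgD; first by apply: cvg_norm; apply: cvgB => //; exact: cvg_cst.
    apply: cvgM; first exact: cvg_cst.
    apply: cvgM => //; apply: cvgD; first exact: density_cvg0 c0 kc.
    by apply: cvgM; [exact: cvg_cst | exact: sqrt_p_cvg0].
  apply/cvgrPdist_le => e e0; near=> n.
  have p4 : 0 < p n <= 4^-1.
    have /andP[-> _] := p_itv n.
    by near: n; apply: (cvgr_le _ p_to0); rewrite invr_gt0.
  have [ov _] := CP n (l n) (p n) (l_gt1 n) p4.
  rewrite distrC.
  have := @poisson_AP_count R n (l n) (p n) (p_itv n) (l_gt1 n) (c / 2)
    (fun k => (k%:R <= x)%R) l0.
  move=> /le_trans; apply.
  apply: (@le_trans _ _ (err n)); last by near: n; apply: (cvgr_le _ err0).
  by rewrite ler_wpM2l ?expR_ge0 // lerD2r lerD2l ler_wpM2l.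
have s3 := cluster_ratio_cvg0 l_ge3 l_const_or_slow p_itv p_to0 ky.
have V0 := count_var_gt0 l_ge3 l_const_or_slow p_itv p_to0.
under eq_fun do rewrite (cdf_standardize_AP_count _ (A_binomial _)).
rewrite cdf_std_normal; apply/fine_cvgP; split; first exact: nearW.
rewrite /comp /=.
pose W n := centred_sum (p n) (Num.sqrt (count_var (p n) (APs n (l n))))^-1 (APs n (l n)).
have p01 n : 0 <= p n <= 1 by have /andP[/ltW -> ->] := p_itv n.
(* Each test function only bounds the mean of an indicator from above. If c > 1 the bound is
   trivial, so test functions are requested for c <= 1 only. *)
have stein (I : R -> bool) (c e : R) : 0 < e -> (c <= 1 -> exists (f f' : R -> R) (K : R),
    [/\ forall v w, `|f w - f v - f' v * (w - v)| <= K * (w - v) ^+ 2,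
      forall v w, `|f' w - f' v| <= K * `|w - v| &
      forall w : R, (I w)%:R - c <= f' w - w * f w]) ->
    \forall n \near \oo, mean (p n) (fun S => (I (W n S))%:R) <= c + e.
  move=> e0 test; have [c1|c1] := leP c 1; last first.
    near=> n; apply: (@le_trans _ _ 1); last by lra.
    rewrite -[leRHS](mean1 'I_n (p n)); apply: le_mean => // S.
    by case: (I _).
  have [f [f' [K [f_taylor f'_lip fI]]]] := test c1.
  near=> n; have Vn : 0 < count_var (p n) (APs n (l n)) by near: n.
  rewrite -lerBlDl -[X in _ - X](mean_cst 'I_n (p n)) -meanB.
  apply: le_trans (le_mean (p01 n) (fun S => fI (W n S))) _.
  apply: le_trans (ler_norm _) _.
  apply: le_trans (normal_AP_count (p_itv n) Vn f_taylor f'_lip) _.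
  by near: n; exact: cvg0_le_eventually.
apply/cvgrPdist_le => e e0; have e2 : 0 < e / 2 by rewrite divr_gt0.
set phi := std_normal_cdf x.
have up : \forall n \near \oo, mean (p n) (fun S => (W n S <= x)%R%:R) <= phi + e / 2 + e / 2.
  apply: (stein (fun w => (w <= x)%R)) => // c1; apply: std_normal_stein_test.
  by rewrite c1 ltrDl e2.
have lo : \forall n \near \oo,
    mean (p n) (fun S => (x < W n S)%R%:R) <= 1 - phi + e / 2 + e / 2.
  apply: (stein (fun w => (x < w)%R)) => // c1; apply: std_normal_stein_testN.
  by rewrite c1 ltrDl e2.
near=> n.
have up_n : mean (p n) (fun S => (W n S <= x)%R%:R) <= phi + e / 2 + e / 2 by near: n.
have lo_n : mean (p n) (fun S => (x < W n S)%R%:R) <= 1 - phi + e / 2 + e / 2 by near: n.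
(* The upper bound for the complementary event becomes the missing lower bound. *)
have compl : mean (p n) (fun S => (x < W n S)%R%:R) =
    1 - mean (p n) (fun S => (W n S <= x)%R%:R).
  rewrite -[X in _ = X - _](mean1 'I_n (p n)) -meanB; apply: eq_mean => S.
  by rewrite ltNge; case: (_ <= _)%R; rewrite ?subrr ?subr0.
rewrite ler_norml; move: lo_n up_n; rewrite compl -/(W n).
by move: (mean _ _) => t; lra.
Unshelve. all: by end_near.
Qed.
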